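(* Let $\{P_\lambda:\lambda\in\Lambda\}$ be a family of regular Markov operators on a complete separable metric space $(S,d)$, and let $U_\lambda$ be the dual Markov operator of $P_\lambda$. The following statements are equivalent: (i) $\{U_\lambda f:\lambda\in\Lambda\}$ is equicontinuous in $C_b(S)$ for every $f\in\mathrm{BL}(S)$; (ii) $\{P_\lambda:\lambda\in\Lambda\}$ is equicontinuous in $C(\mathcal{M}^+(S)_{\mathrm{BL}},\mathcal{M}^+(S)_{\mathrm{BL}})$; (iii) $\{P_\lambda:\lambda\in\Lambda\}$ (restricted to $\mathcal{P}(S)$) is equicontinuous in $C(\mathcal{P}(S)_{\mathrm{weak}},\mathcal{P}(S)_{\mathrm{BL}})$.
   Context: $\mathcal{M}(S)$ is the space of finite signed Borel measures on $S$, $\mathcal{M}^+(S)$ the cone of positive ones, $\mathcal{P}(S)$ the set of Borel probability measures, and $\langle\mu,f\rangle:=\int_S f\,d\mu$. $\mathrm{BL}(S)$ is the space of bounded real-valued Lipschitz functions on $(S,d)$ with norm $\|f\|_{\mathrm{BL}}:=\|f\|_\infty+|f|_L$, where $|f|_L:=\sup\{|f(x)-f(y)|/d(x,y):x\neq y\}$. The dual bounded Lipschitz norm on $\mathcal{M}(S)$ is $\|\mu\|_{\mathrm{BL}}^*:=\sup\{|\langle\mu,f\rangle|:f\in\mathrm{BL}(S),\ \|f\|_{\mathrm{BL}}\le1\}$. $\mathcal{M}^+(S)_{\mathrm{BL}}$ and $\mathcal{P}(S)_{\mathrm{BL}}$ denote $\mathcal{M}^+(S)$ and $\mathcal{P}(S)$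 with the metric $(\mu,\nu)\mapsto\|\mu-\nu\|_{\mathrm{BL}}^*$; $\mathcal{P}(S)_{\mathrm{weak}}$ is $\mathcal{P}(S)$ with the weak topology induced by pairing with $C_b(S)$ (bounded continuous real functions). A Markov operator on $S$ is a map $P:\mathcal{M}^+(S)\to\mathcal{M}^+(S)$ with $P(\mu+\nu)=P\mu+P\nu$, $P(r\mu)=rP\mu$ for all $\mu,\nu\in\mathcal{M}^+(S)$, $r\ge0$, and $(P\mu)(S)=\mu(S)$ for all $\mu\in\mathcal{M}^+(S)$. Let $\mathrm{BM}(S)$ be the vector space of bounded Borel measurable real functions on $S$. $P$ is regular if there is a linear map $U:\mathrm{BM}(S)\to\mathrm{BM}(S)$ (the dual operator) with $\langle P\mu,f\rangle=\langle\mu,Uf\rangle$ for all $\mu\in\mathcal{M}^+(S)$, $f\in\mathrm{BM}(S)$. For a topological space $T$ and a metric space $(S',d')$, a family $\mathcal{E}$ of functions in $C(T,S')$ (continuous maps $T\to S'$) is equicontinuous at $t_0\in T$ if for every $\varepsilon>0$ there is an open neighbourhood $U_\varepsilon$ of $t_0$ such that $d'(f(t),f(t_0))<\varepsilon$ for all $f\in\mathcal{E}$, $t\in U_\varepsilon$; it is equicontinuous if it is equicontinuous at every point of $T$. Saying that a family of maps is equicontinuous in $C(T,S')$ (or in $C_b(S)$) includes that its members belong to that space; in (i), the target is $\mathbb{R}$ with its usual metric. *)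

(* Defs.v *)
From HB Require Import structures.
From mathcomp Require Import all_boot all_order all_algebra.
From mathcomp Require Import all_classical all_reals all_analysis.
From mathcomp Require Import measurable_realfun ring lra.

Set Implicit Arguments.
Unset Strict Implicit.
Unset Printing Implicit Defensive.

Import Order.TTheory GRing.Theory Num.Theory.
Import numFieldNormedType.Exports.

Local Open Scope classical_set_scope.
Local Open Scope ring_scope.

(* Library measurable types and complete uniform spaces carry a point. *)
#[short(type="pmetricType")]
HB.structure Definition PointedMetric (R : numDomainType) :=
  {T of Metric R T & isPointed T}.

#[short(type="completeMetricType")]
HB.structure Definition CompleteMetric (R : numDomainType) :=
  {T of Metric R T & Complete T}.

Notation borel S := (g_sigma_algebraType (@open S)).

Section function_spaces.
Context {R : realType} (S : pmetricType R).
Implicit Type f : S -> R.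

Definition is_lipschitz f :=
  exists k : R, forall x y, `|f x - f y| <= k * mdist x y.

Definition BL : set (S -> R) := [set f | bounded_fun f /\ is_lipschitz f].

Definition sup_norm f : R := sup [set `|f x| | x in [set: S]].

(* [sup set0 = 0], so this is 0 on a one-point space. *)
Definition lip_seminorm f : R :=
  sup [set `|f p.1 - f p.2| / mdist p.1 p.2 | p in [set p : S * S | p.1 <> p.2]].

Definition BL_norm f : R := sup_norm f + lip_seminorm f.

Definition Cb : set (S -> R^o) := [set f | continuous f /\ bounded_fun f].

Definition BM_pred : {pred borel S -> R} :=
  mem [set f : borel S -> R | measurable_fun [set: borel S] f /\ bounded_fun f].

Record BM := MkBM {
  BM_val :> borel S -> R ;
  BM_valP : BM_val \in BM_pred
}.

HB.instance Definition _ := [isSub for BM_val].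
HB.instance Definition _ := [Choice of BM by <:].

Lemma bounded_funE f : bounded_fun f <-> exists M : R, forall x, `|f x| <= M.
Proof.
split=> [[M [_ fM]]|[M fM]].
  by exists (M + 1) => x; apply: fM => //; rewrite ltrDl.
exists M; split => [|x Mx y _]; first exact: num_real.
exact: le_trans (fM y) (ltW Mx).
Qed.

Fact BM_submod_closed : submod_closed BM_pred.
Proof.
split=> [|a f g /set_mem[mf /bounded_funE[M fM]] /set_mem[mg /bounded_funE[N gN]]].
  by apply/mem_set; split; [exact: measurable_cst|
    apply/bounded_funE; exists 0 => x; rewrite normr0].
apply/mem_set; split.
  by apply: measurable_funD => //; exact: measurable_funM.
apply/bounded_funE; exists (`|a| * M + N) => x.
apply: le_trans (ler_normD _ _) _; apply: lerD; last exact: gN.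
by rewrite normrM ler_wpM2l.
Qed.

HB.instance Definition _ :=
  GRing.isSubmodClosed.Build _ _ BM_pred BM_submod_closed.
HB.instance Definition _ := [SubChoice_isSubLmodule of BM by <:].

Lemma lipschitz_continuous f : is_lipschitz f -> continuous (f : S -> R^o).
Proof.
move=> [k fk] x; apply/cvgrPdist_lt => /= e e0.
have k0 : 0 < `|k| + 1 by rewrite ltr_pwDr.
near=> y.
have xy : mdist x y < e / (`|k| + 1).
  near: y; have := nbhsx_ballx x (e / (`|k| + 1)) (divr_gt0 e0 k0).
  by rewrite ballEmdist.
apply: le_lt_trans (fk x y) _; rewrite ltr_pdivlMr// in xy.
apply: le_lt_trans xy; rewrite mulrC ler_wpM2l ?mdist_ge0//.
by rewrite (le_trans (ler_norm _))// lerDl.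
Unshelve. all: by end_near. Qed.

Lemma continuous_borel f :
  continuous (f : S -> R^o) -> measurable_fun [set: borel S] (f : borel S -> R).
Proof.
move=> /continuousP cf; apply: (measurability _ (RGenOpens.measurableE R)).
move=> _ [_ [a [b ->] <-]]; rewrite setTI; apply: sub_sigma_algebra.
exact/cf/interval_open.
Qed.

(* BL(S) is contained in BM(S). *)
Lemma BL_BM f : BL f -> exists g : BM, (g : S -> R) = f.
Proof.
move=> [bf lf]; have mf := continuous_borel (lipschitz_continuous lf).
by exists (MkBM (mem_set (conj mf bf))).
Qed.

End function_spaces.
Arguments Cb {R} S _.

Section finite_measure_add.
Context d (T : measurableType d) (R : realType).
Variables mu nu : {finite_measure set T -> \bar R}.

Let fin_num_measure_add : fin_num_fun (measure_add mu nu).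
Proof. by move=> A mA; rewrite measure_addE fin_numD !fin_num_measure. Qed.

HB.instance Definition _ := Measure.on (measure_add mu nu).
HB.instance Definition _ :=
  @Measure_isFinite.Build _ T _ (measure_add mu nu) fin_num_measure_add.

End finite_measure_add.

Section measures.
Context {R : realType} (S : pmetricType R).
Implicit Types f : S -> R.

(* M^+(S). A library measure is a function on all sets, constrained only on the
   measurable ones; imposing the value 0 elsewhere makes Leibniz equality of
   [posmeas] coincide with equality of Borel measures ([posmeas_eq]). *)
Record posmeas := PosMeas {
  posmeas_val :> {finite_measure set (borel S) -> \bar R} ;
  posmeas_out : forall A : set (borel S), ~ measurable A -> posmeas_val A = 0%E
}.

Lemma posmeas_eq (mu nu : posmeas) :
  (forall A : set (borel S), measurable A -> mu A = nu A) -> mu = nu.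
Proof.
move=> munu.
have : FiniteMeasure.sort mu = FiniteMeasure.sort nu.
  apply/funext => A; have [mA|nA] := pselect (measurable A); first exact: munu.
  by rewrite !posmeas_out.
case: mu nu {munu} => [[m [[? ?] [?] [?] [?] [?]]] ?] [[n [[? ?] [?] [?] [?] [?]]] ?].
move=> /= mn; subst n.
by repeat match goal with H1 : ?P, H2 : ?P |- _ =>
  have E := Prop_irrelevance H1 H2; subst H1 end.
Qed.

Section operations.
Variables (mu nu : posmeas) (r : {nonneg R}).

Fact posmeas_add_out (A : set (borel S)) :
  ~ measurable A -> measure_add mu nu A = 0%E.
Proof. move=> nA; rewrite measure_addE -[RHS]adde0.
by congr (_ + _)%E; exact: posmeas_out. Qed.

Definition posmeas_add : posmeas :=
  @PosMeas (measure_add mu nu) posmeas_add_out.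

Fact posmeas_scale_out (A : set (borel S)) :
  ~ measurable A -> mscale r mu A = 0%E.
Proof. move=> nA; rewrite /mscale -[RHS](mule0 r%:num%:E).
by congr (_ * _)%E; exact: posmeas_out. Qed.

Definition posmeas_scale : posmeas :=
  @PosMeas (mscale r mu) posmeas_scale_out.

End operations.

Definition pairing (mu : {finite_measure set (borel S) -> \bar R}) f : R :=
  \int[mu]_x f x.

(* [charge_pairing nu f] does not depend on the chosen decomposition. *)
Definition hahn_pair (nu : {charge set (borel S) -> \bar R}) :
  {P : set (borel S) & {N : set (borel S) | hahn_decomposition nu P N}}.
Proof.
have [P /cid[N PN]] := cid (Hahn_decomposition nu).
by exists P, N.
Defined.

Definition charge_pairing (nu : {charge set (borel S) -> \bar R}) f : R :=
  let nuPN := projT2 (projT2 (hahn_pair nu)) in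
  pairing (jordan_pos nuPN) f - pairing (jordan_neg nuPN) f.

(* The library's charges are the finite signed measures, i.e. M(S). *)
Definition BL_dual_norm (nu : {charge set (borel S) -> \bar R}) : R :=
  sup [set `|charge_pairing nu f| | f in [set f | BL f /\ BL_norm f <= 1]].

Definition posmeas_sub (mu nu : posmeas) : {charge set (borel S) -> \bar R} :=
  cadd (charge_of_finite_measure mu) (copp (charge_of_finite_measure nu)).

Definition BL_dist (mu nu : posmeas) : R := BL_dual_norm (posmeas_sub mu nu).

Fact fin_num_subE (a b c e : \bar R) : a \is a fin_num -> b \is a fin_num ->
  c \is a fin_num -> e \is a fin_num -> (a - b = c - e -> a + e = b + c)%E.
Proof.
move: a b c e => [a| |] [b| |] [c| |] [e| |] // _ _ _ _ [abce].
by rewrite -!EFinD; congr EFin; rewrite -[a](subrK b) abce; ring.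
Qed.

Lemma charge_pairing_sub (mu nu : posmeas) f :
  measurable_fun [set: borel S] (f : borel S -> R) -> bounded_fun f ->
  charge_pairing (posmeas_sub mu nu) f = pairing mu f - pairing nu f.
Proof.
move=> mf bf; rewrite /charge_pairing.
case: (hahn_pair _) => P [N PN] /=.
set p := jordan_pos PN; set n := jordan_neg PN.
have intf (m : {finite_measure set (borel S) -> \bar R}) :
    m.-integrable [set: borel S] (EFin \o f).
  apply: measurable_bounded_integrable => //.
  by rewrite -ge0_fin_numE// fin_num_measure.
have fint (m : {finite_measure set (borel S) -> \bar R}) :
    (\int[m]_x (f x)%:E)%E \is a fin_num.
  by apply: integrable_fin_num => //; exact: intf.
have munp A : measurable A -> measure_add mu n A = measure_add nu p A.
  move=> mA; rewrite !measure_addE; apply: fin_num_subE.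
  - exact: (fin_num_measure mu).
  - exact: (fin_num_measure nu).
  - exact: (fin_num_measure p).
  - exact: (fin_num_measure n).
  - have : (mu A - nu A = p A + (-1)%:E * n A)%E := jordan_decomp PN mA.
    by rewrite EFinN mulN1e.
have E : (\int[mu]_x (f x)%:E + \int[n]_x (f x)%:E =
          \int[nu]_x (f x)%:E + \int[p]_x (f x)%:E)%E.
  rewrite -!integral_measure_add//; try exact/measurable_EFinP; try exact: intf.
  by apply: eq_measure_integral => A mA _; exact: munp.
move: E; change (charge_pairing _ f) with (pairing p f - pairing n f).
rewrite /pairing /Rintegral.
move: (fint mu) (fint nu) (fint p) (fint n).
move: (\int[mu]_x (f x)%:E)%E (\int[nu]_x (f x)%:E)%E.
move: (\int[p]_x (f x)%:E)%E (\int[n]_x (f x)%:E)%E.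
move=> [c| |] [e| |] [a| |] [b| |] // _ _ _ _ [abce] /=.
by rewrite -[a](addrK e) abce; ring.
Qed.

End measures.

Section BL_metric.
Context {R : realType} (S : pmetricType R).
Implicit Types (f : S -> R) (mu nu : posmeas S).

Let unit_ball : set (S -> R) := [set f | BL f /\ BL_norm f <= 1].

Lemma lip_seminorm_ge0 f : 0 <= lip_seminorm f.
Proof.
rewrite /lip_seminorm; set A := (X in sup X).
have A0 a : A a -> 0 <= a.
  by move=> [p _ <-]; rewrite divr_ge0// mdist_ge0.
have [[[a Aa] ubA]|/sup_out->//] := pselect (has_sup A).
by rewrite (le_trans (A0 _ Aa))//; apply: sup_upper_bound => //; split => //; exists a.
Qed.

Lemma unit_ball_le1 f : unit_ball f -> forall x, `|f x| <= 1.
Proof.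
move=> [[/bounded_funE[M fM] _] f1] x; apply: le_trans f1.
rewrite -[leLHS]addr0 lerD ?lip_seminorm_ge0//.
apply: sup_upper_bound; last by exists x.
by split; [exists `|f x|, x | exists M => _ [y _ <-]].
Qed.

Lemma BL_norm_le f (M k : R) : 0 <= k -> (forall x, `|f x| <= M) ->
  (forall x y, `|f x - f y| <= k * mdist x y) -> BL_norm f <= M + k.
Proof.
move=> k0 fM fk; apply: lerD.
  by apply: ge_sup; [exists `|f point|, point | move=> _ [y _ <-]].
rewrite /lip_seminorm; set A := (X in sup X).
have [->|/set0P A0] := eqVneq A set0; first by rewrite sup0.
apply: ge_sup => // _ [[x y] /= /eqP xy <-].
by rewrite ler_pdivrMr ?mdist_gt0.
Qed.

Lemma unit_ball0 : unit_ball (cst 0).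
Proof.
split; first split.
- by apply/bounded_funE; exists 0 => x; rewrite normr0.
- by exists 0 => x y; rewrite subrr normr0 mul0r.
rewrite (@le_trans _ _ (0 + 0))// ?addr0//.
have := @BL_norm_le (cst 0) 0 0; rewrite addr0; apply => //= *.
- by rewrite normr0.
- by rewrite subrr normr0 mul0r.
Qed.

Lemma BL_measurable f :
  BL f -> measurable_fun [set: borel S] (f : borel S -> R).
Proof. by move=> [_ /lipschitz_continuous/continuous_borel]. Qed.

Lemma bounded_integrable (mu : posmeas S) f :
  measurable_fun [set: borel S] (f : borel S -> R) -> bounded_fun f ->
  mu.-integrable [set: borel S] (EFin \o f).
Proof.
move=> mf bf; apply: measurable_bounded_integrable => //.
by rewrite -ge0_fin_numE// fin_num_measure.
Qed.

Lemma BL_integrable mu f : BL f -> mu.-integrable [set: borel S] (EFin \o f).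
Proof.
by move=> BLf; apply: bounded_integrable; [exact: BL_measurable|case: BLf].
Qed.

Lemma pairing_le_mass mu f : unit_ball f ->
  `|pairing mu f| <= fine (mu [set: borel S]).
Proof.
move=> f1; have mf := BL_integrable mu f1.1.
apply: le_trans (le_normr_Rintegral _ mf) _ => //.
rewrite -[leRHS]mul1r -Rintegral_cst//; apply: le_Rintegral => //.
- exact: (integrable_norm mf).
- by apply: (@bounded_integrable _ (cst 1)) => //; exact: bounded_cst.
- by move=> x _; exact: unit_ball_le1.
Qed.

Lemma BL_distE mu nu :
  BL_dist mu nu = sup [set `|pairing mu f - pairing nu f| | f in unit_ball].
Proof.
congr sup; apply: eq_imagel => f [BLf _].
by rewrite charge_pairing_sub//; [exact: BL_measurable|case: BLf].
Qed.

Lemma BL_dist_has_sup mu nu :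
  has_sup [set `|pairing mu f - pairing nu f| | f in unit_ball].
Proof.
split; first by eexists; exists (cst 0); [exact: unit_ball0|reflexivity].
exists (fine (mu [set: borel S]) + fine (nu [set: borel S])) => _ [f f1 <-].
by rewrite (le_trans (ler_normB _ _))// lerD// pairing_le_mass.
Qed.

Lemma BL_dist_ub mu nu f : unit_ball f ->
  `|pairing mu f - pairing nu f| <= BL_dist mu nu.
Proof.
by move=> f1; rewrite BL_distE; apply: sup_upper_bound;
  [exact: BL_dist_has_sup|exists f].
Qed.

Lemma BL_distxx mu : BL_dist mu mu = 0.
Proof.
apply/eqP; rewrite eq_le; apply/andP; split.
  rewrite BL_distE; apply: ge_sup; first exact: (BL_dist_has_sup mu mu).1.
  by move=> _ [f _ <-]; rewrite subrr normr0.
exact: le_trans (BL_dist_ub mu mu unit_ball0).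
Qed.

Lemma BL_dist_sym mu nu : BL_dist mu nu = BL_dist nu mu.
Proof.
by rewrite !BL_distE; congr sup; apply: eq_imagel => f _; rewrite distrC.
Qed.

Lemma BL_dist_triangle nu mu la :
  BL_dist mu la <= BL_dist mu nu + BL_dist nu la.
Proof.
rewrite BL_distE; apply: ge_sup; first exact: (BL_dist_has_sup mu la).1.
move=> _ [f f1 <-]; apply: le_trans (ler_distD (pairing nu f) _ _) _.
by rewrite lerD// BL_dist_ub.
Qed.

Lemma BL_dist_eq0_pairing mu nu f :
  BL_dist mu nu = 0 -> BL f -> pairing mu f = pairing nu f.
Proof.
move=> d0 BLf; have [/bounded_funE[M fM] [k fk]] := BLf.
have M0 : 0 <= M by exact: le_trans (fM point).
have D0 : 0 < 1 + M + `|k| by rewrite -addrA ltr_pwDl// addr_ge0.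
pose c := (1 + M + `|k|)^-1; have c0 : 0 < c by rewrite invr_gt0.
have cf1 : unit_ball (fun x => c * f x).
  have cM x : `|c * f x| <= c * M by rewrite normrM (gtr0_norm c0) ler_pM2l.
  have ck x y : `|c * f x - c * f y| <= c * `|k| * mdist x y.
    rewrite -mulrBr normrM (gtr0_norm c0) -mulrA ler_pM2l//.
    by rewrite (le_trans (fk _ _))// ler_wpM2r ?mdist_ge0// ler_norm.
  split; first split.
  - by apply/bounded_funE; exists (c * M).
  - by exists (c * `|k|).
  apply: le_trans (BL_norm_le _ cM ck) _; first by rewrite mulr_ge0// ltW.
  by rewrite -mulrDr mulrC ler_pdivrMr// mul1r -addrA lerDr.
have := BL_dist_ub mu nu cf1; rewrite d0 normr_le0 subr_eq0 => /eqP.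
rewrite /pairing !RintegralZl//; try exact: BL_integrable.
by move/mulfI; apply; rewrite gt_eqF.
Qed.

Let setdist (C : set S) x : R := inf [set mdist x y | y in C].

Let setdist_has_inf (C : set S) x : C !=set0 -> has_inf [set mdist x y | y in C].
Proof.
by move=> [y Cy]; split; [exists (mdist x y), y |
  exists 0 => _ [z _ <-]; exact: mdist_ge0].
Qed.

Let setdist_ge0 (C : set S) x : C !=set0 -> 0 <= setdist C x.
Proof.
move=> C0; apply: lb_le_inf; first exact: (setdist_has_inf x C0).1.
by move=> _ [z _ <-]; exact: mdist_ge0.
Qed.

Let setdist_le (C : set S) x y : C y -> setdist C x <= mdist x y.
Proof.
by move=> Cy; apply: inf_lbound; [exists 0 => _ [z _ <-]; exact: mdist_ge0|exists y].
Qed.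

Let setdist_lip (C : set S) x y : C !=set0 ->
  setdist C x - setdist C y <= mdist x y.
Proof.
move=> C0; rewrite lerBlDr -lerBlDl.
apply: lb_le_inf; first exact: (setdist_has_inf y C0).1.
move=> _ [z Cz <-]; rewrite lerBlDl.
exact: le_trans (setdist_le x Cz) (metric_triangle x y z).
Qed.

Let approx (C : set S) (n : nat) x : R := Num.min 1 (n%:R * setdist C x).

Let approx_BL C n : C !=set0 -> BL (approx C n).
Proof.
move=> C0; split.
  apply/bounded_funE; exists 1 => x.
  by rewrite ger0_norm /approx ?le_min ?ge_min ?lexx//= ler01 mulr_ge0// setdist_ge0.
exists n%:R => x y.
have h : `|setdist C x - setdist C y| <= mdist x y.
  by rewrite ler_norml setdist_lip// andbT lerNl opprB metric_sym setdist_lip.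
apply: le_trans (_ : n%:R * `|setdist C x - setdist C y| <= _); last first.
  exact: ler_wpM2l.
rewrite -{1}(ger0_norm (ler0n R n)) -normrM mulrBr /approx.
move: (_ * setdist C x) (_ * setdist C y) => a b; rewrite /Num.min.
case: ltP => a1; case: ltP => b1; rewrite ?subrr ?normr0 ?normr_ge0//.
- by rewrite !ger0_norm; lra.
- by rewrite !ler0_norm; lra.
Qed.

Lemma BL_dist_eq0_open mu nu (O : set (borel S)) :
  BL_dist mu nu = 0 -> open (O : set S) -> mu O = nu O.
Proof.
move=> d0 oO; have mO : measurable O by exact: sub_sigma_algebra.
have pairE m (f : S -> R) (mf : measurable_fun [set: borel S] (f : borel S -> R))
    (bf : bounded_fun f) : (\int[posmeas_val m]_x (f x)%:E)%E = (pairing m f)%:E.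
  by rewrite fineK//; apply: integrable_fin_num => //; exact: bounded_integrable.
have [C0|/set0P C0] := eqVneq (~` O : set S) set0.
  have -> : O = [set: borel S] by rewrite -(setCK O) C0 setC0.
  have b1 : BL (cst 1 : S -> R).
    split; first exact: bounded_cst.
    by exists 0 => x y; rewrite subrr normr0 mul0r.
  have := BL_dist_eq0_pairing d0 b1.
  rewrite /pairing !Rintegral_cst// !mul1r => h.
  by rewrite -(fineK (fin_num_measure mu _ measurableT)) h fineK// fin_num_measure.
pose f n : borel S -> R := approx (~` O) n.
have BLf n : BL (f n) by exact: approx_BL.
have mf n := BL_measurable (BLf n).
have f01 n x : 0 <= f n x <= 1.
  by rewrite /f /approx le_min ge_min lexx ler01 mulr_ge0// setdist_ge0.
have cvgf x : (f n x)%:E @[n --> \oo] --> ((\1_O x)%:E : \bar R).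
  have [Ox|nOx] := pselect (O x); rewrite indicE.
    rewrite mem_set//=; apply: cvg_near_cst.
    have : nbhs (x : S) (O : set S) by exact: open_nbhs_nbhs.
    move=> /nbhs_ballP[e /= e0 xeO].
    have de : e <= setdist (~` O) x.
      apply: lb_le_inf; first exact: (setdist_has_inf x C0).1.
      move=> _ [z Cz <-]; rewrite leNgt; apply/negP => xz; apply: Cz.
      by apply: xeO; rewrite ballEmdist.
    near=> n; congr EFin; apply/eqP; rewrite eq_le (andP (f01 n x)).2/=.
    rewrite /f /approx le_min lexx/=.
    apply: le_trans (_ : n%:R * e <= _); last exact: ler_wpM2l.
    rewrite -ler_pdivrMr//; near: n; exact: nbhs_infty_ger.
  rewrite memNset//=; apply: cvg_near_cst; near=> n; congr EFin.
  have -> : f n x = Num.min 1 (n%:R * 0).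
    congr (Num.min _ (_ * _)); apply/eqP.
    by rewrite eq_le setdist_ge0// andbT (le_trans (setdist_le x nOx))// mdistxx.
  by rewrite mulr0 /Num.min ltNge ler01.
have lim m : (\int[posmeas_val m]_x (f n x)%:E)%E @[n --> \oo] --> m O.
  have -> : m O = (\int[posmeas_val m]_x (\1_O x)%:E)%E.
    by rewrite integral_indic// setIT.
  have [] // := @dominated_convergence _ _ _ (posmeas_val m) setT measurableT
     (fun n x => (f n x)%:E) (fun x => (\1_O x)%:E) (cst 1%E).
  - by move=> n; exact/measurable_EFinP.
  - exact/measurable_EFinP/measurable_indic.
  - by apply: aeW => x _; exact: cvgf.
  - by apply: (@bounded_integrable _ (cst 1)) => //; exact: bounded_cst.
  - by apply: aeW => x n _; have /andP[f0 f1] := f01 n x; rewrite lee_fin ger0_norm.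
have := lim nu; rewrite (_ : (fun n => _) =
    (fun n => (\int[posmeas_val mu]_x (f n x)%:E)%E)); last first.
  apply/funext => n; rewrite !pairE//; try by case: (BLf n).
  by congr EFin; rewrite (BL_dist_eq0_pairing d0 (BLf n)).
by move=> lnu; exact: (cvg_unique _ (lim mu) lnu).
Unshelve. all: by end_near. Qed.

Lemma BL_dist_eq0 mu nu : BL_dist mu nu = 0 -> mu = nu.
Proof.
move=> d0; apply: posmeas_eq => A mA.
apply: (@g_sigma_algebra_measure_unique _ R (borel S) (@open S) _ (fun=> setT)
  _ _ (posmeas_val mu) (posmeas_val nu)) => //.
- by move=> B oB; exact: sub_sigma_algebra.
- by move=> _; exact: openT.
- by rewrite bigcup_const//; exists 0%N.
- exact: openI.
- by move=> B oB; exact: BL_dist_eq0_open.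
- by move=> _; rewrite -ge0_fin_numE// fin_num_measure.
Qed.

End BL_metric.

(* M^+(S) with the dual bounded Lipschitz metric. *)
Definition posmeas_BL {R : realType} (S : pmetricType R) : Type := posmeas S.

HB.instance Definition _ {R : realType} (S : pmetricType R) :=
  gen_eqMixin (posmeas_BL S).
HB.instance Definition _ {R : realType} (S : pmetricType R) :=
  gen_choiceMixin (posmeas_BL S).
HB.instance Definition _ {R : realType} (S : pmetricType R) :=
  @isMetric.Build R (posmeas_BL S) (@BL_dist R S) (@BL_distxx R S)
    (@BL_dist_eq0 R S) (@BL_dist_sym R S) (@BL_dist_triangle R S).

Section probabilities.
Context {R : realType} (S : pmetricType R).

Record prob := Prob {
  prob_val :> posmeas S ;
  prob_mass : prob_val setT = 1%E
}.

Lemma prob_val_inj : injective prob_val.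
Proof.
move=> [mu mu1] [nu nu1] /= munu; subst nu.
by congr Prob; exact: Prop_irrelevance.
Qed.

HB.instance Definition _ := gen_eqMixin prob.
HB.instance Definition _ := gen_choiceMixin prob.

Definition prob_BL : Type := prob.

HB.instance Definition _ := Choice.on prob_BL.

Let prob_dist (mu nu : prob_BL) : R := BL_dist mu nu.

Let prob_distxx (mu : prob_BL) : prob_dist mu mu = 0.
Proof. exact: BL_distxx. Qed.

Let prob_dist_eq0 (mu nu : prob_BL) : prob_dist mu nu = 0 -> mu = nu.
Proof. by move=> /BL_dist_eq0 /prob_val_inj. Qed.

Let prob_dist_sym (mu nu : prob_BL) : prob_dist mu nu = prob_dist nu mu.
Proof. exact: BL_dist_sym. Qed.

Let prob_dist_triangle (nu mu la : prob_BL) :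
  prob_dist mu la <= prob_dist mu nu + prob_dist nu la.
Proof. exact: BL_dist_triangle. Qed.

HB.instance Definition _ := @isMetric.Build R prob_BL prob_dist
  prob_distxx prob_dist_eq0 prob_dist_sym prob_dist_triangle.

Definition prob_pairing (f : {f : S -> R^o | Cb S f}) (mu : prob) : R^o :=
  pairing mu (sval f).

(* The coarsest topology making [mu |-> <mu, f>] continuous for all f in C_b(S). *)
Definition prob_weak : Type := sup_topology (fun f : {f : S -> R^o | Cb S f} =>
  Topological.class (initial_topology (prob_pairing f))).

HB.instance Definition _ := Topological.on prob_weak.

End probabilities.

Section markov.
Context {R : realType} (S : pmetricType R).

Record markov_operator := Markov {
  markov_fun :> posmeas S -> posmeas S ;
  markovD : forall mu nu : posmeas S,
    markov_fun (posmeas_add mu nu) = posmeas_add (markov_fun mu) (markov_fun nu) ;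
  markovZ : forall (r : {nonneg R}) (mu : posmeas S),
    markov_fun (posmeas_scale mu r) = posmeas_scale (markov_fun mu) r ;
  markov_mass : forall mu : posmeas S, markov_fun mu setT = mu setT
}.

(* P is regular iff such a U exists; U is then unique (test on Dirac measures). *)
Definition dual_operator (P : markov_operator) (U : {linear BM S -> BM S}) :=
  forall (mu : posmeas S) (f : BM S), pairing (P mu) f = pairing mu (U f).

Definition markov_prob (P : markov_operator) (mu : prob S) : prob S :=
  Prob (etrans (markov_mass P mu) (prob_mass mu)).

End markov.

Section equicontinuity.
Context {R : realType} {T : topologicalType} {S' : metricType R} {I : Type}.
Implicit Type F : I -> T -> S'.

Definition equicontinuous_at F (t0 : T) := forall e : R, 0 < e ->
  exists2 A : set T, open_nbhs t0 A &
    forall i t, A t -> mdist (F i t) (F i t0) < e.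

Definition equicontinuous_in (C : set (T -> S')) F :=
  (forall i, C (F i)) /\ forall t0, equicontinuous_at F t0.

End equicontinuity.

(* Main.v *)
Require Import Defs.
From HB Require Import structures.
From mathcomp Require Import all_boot all_order all_algebra.
From mathcomp Require Import all_classical all_reals all_analysis.
From mathcomp Require Import measurable_realfun ring lra.

Import Order.TTheory GRing.Theory Num.Theory.
Import numFieldNormedType.Exports.

Local Open Scope classical_set_scope.
Local Open Scope ring_scope.

Local Set Implicit Arguments.
Local Unset Strict Implicit.

(** The analytic core is a Schur property of measures ([schur_property]): if
    [<al n, f> - <be n, f>] tends to 0 for each single bounded Lipschitz [f] and
    the masses stay bounded, then the convergence is uniform over the unit ball
    of BL(S), i.e. [BL_dist (al n) (be n)] tends to 0. It is proved by a gliding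
    hump. If the distance does not tend to 0, some test functions in the unit
    ball see a fixed discrepancy along a subsequence. Finitely many functions
    form a net of the unit ball on a finite set ([finite_net]), so subtracting
    a net element and truncating turns such a test function into one that
    vanishes near everything used before, while a cutoff confines it to a
    neighbourhood of a larger finite set carrying almost all the mass
    ([localize_test_function]). The resulting humps have disjoint supports and a
    common Lipschitz constant, so their sum is one bounded Lipschitz function
    on which the discrepancy persists. Finite sets suffice in place of compact
    ones because by separability a finite measure gives little mass to the
    points far from a suitable finite set ([dist1_pairing_small]).

    From (i) to (ii): let [mu n] tend to [mu0] in the dual norm and take
    operators [P (la n)]. For a bounded Lipschitz [f] the functions [U l f] are
    uniformly bounded and equicontinuous. Such a family is tested uniformly by
    measures converging in the dual norm ([equicontinuous_tests_uniform]): its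
    members are bounded above by their Lipschitz envelopes, and the gap between
    the two is uniformly small off a set of small [mu0]-measure. Hence
    [<P (la n) (mu n), f> - <P (la n) mu0, f>] tends to 0, and the Schur property
    makes this uniform in [f].

    From (ii) to (iii) it is enough that the weak topology on probabilities is
    finer than the dual norm topology ([BL_dist_weak_near]), which follows from
    the same finite nets. From (iii) to (i), evaluate at Dirac measures:
    [U l f x = <P l (dirac x), f>], and [dirac] is weakly continuous. *)

(** * Integration of bounded Borel functions *)

Section pairing_calculus.
Context {R : realType} {S : pmetricType R}.
Implicit Types (f g : S -> R) (mu nu : posmeas S).

Definition bounded_borel f :=
  measurable_fun [set: borel S] (f : borel S -> R) /\ bounded_fun f.

Lemma BL_bounded_borel f : BL f -> bounded_borel f.
Proof. by move=> BLf; split; [exact: BL_measurable | case: BLf]. Qed.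

Lemma bounded_borel_cst (c : R) : bounded_borel (cst c : S -> R).
Proof. by split; [exact: measurable_cst | exact: bounded_cst]. Qed.

Lemma bounded_borelB f g :
  bounded_borel f -> bounded_borel g -> bounded_borel (fun x => f x - g x).
Proof.
move=> [mf /bounded_funE[M fM]] [mg /bounded_funE[N gN]]; split.
  exact: measurable_funB.
apply/bounded_funE; exists (M + N) => x.
by rewrite (le_trans (ler_normB _ _))// lerD.
Qed.

Lemma bounded_borelD f g :
  bounded_borel f -> bounded_borel g -> bounded_borel (fun x => f x + g x).
Proof.
move=> [mf /bounded_funE[M fM]] [mg /bounded_funE[N gN]]; split.
  exact: measurable_funD.
apply/bounded_funE; exists (M + N) => x.
by rewrite (le_trans (ler_normD _ _))// lerD.
Qed.

Lemma bounded_borelZ (c : R) f : bounded_borel f -> bounded_borel (fun x => c * f x).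
Proof.
move=> [mf /bounded_funE[M fM]]; split; first exact: measurable_funM.
by apply/bounded_funE; exists (`|c| * M) => x; rewrite normrM ler_wpM2l.
Qed.

Lemma pairingB mu f g : bounded_borel f -> bounded_borel g ->
  pairing mu (fun x => f x - g x) = pairing mu f - pairing mu g.
Proof. by move=> [? ?] [? ?]; rewrite /pairing RintegralB//; exact: bounded_integrable. Qed.

Lemma pairingD mu f g : bounded_borel f -> bounded_borel g ->
  pairing mu (fun x => f x + g x) = pairing mu f + pairing mu g.
Proof. by move=> [? ?] [? ?]; rewrite /pairing RintegralD//; exact: bounded_integrable. Qed.

Lemma pairingZ mu (c : R) f : bounded_borel f ->
  pairing mu (fun x => c * f x) = c * pairing mu f.
Proof. by move=> [? ?]; rewrite /pairing RintegralZl//; exact: bounded_integrable. Qed.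

Definition mass mu : R := fine (mu [set: borel S]).

Lemma mass_ge0 mu : 0 <= mass mu.
Proof. exact: fine_ge0. Qed.

Lemma pairing_cst mu (c : R) : pairing mu (cst c) = c * mass mu.
Proof. by rewrite /pairing Rintegral_cst. Qed.

Lemma pairing_indic mu (A : set (borel S)) :
  measurable A -> pairing mu (\1_A : borel S -> R) = fine (mu A).
Proof. by move=> mA; rewrite /pairing /Rintegral integral_indic// setIT. Qed.

Lemma bounded_borel_indic (A : set (borel S)) :
  measurable A -> bounded_borel (\1_A : borel S -> R).
Proof.
move=> mA; split; first exact: measurable_indic.
by apply/bounded_funE; exists 1 => x; rewrite indicE; case: (_ \in _); rewrite ?normr1 ?normr0.
Qed.

Lemma le_pairing mu f g : bounded_borel f -> bounded_borel g ->
  (forall x, f x <= g x) -> pairing mu f <= pairing mu g.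
Proof.
by move=> [? ?] [? ?] fg; apply: le_Rintegral => //; exact: bounded_integrable.
Qed.

Lemma le_norm_pairing mu f g : bounded_borel f -> bounded_borel g ->
  (forall x, `|f x| <= g x) -> `|pairing mu f| <= pairing mu g.
Proof.
move=> bf bg fg; rewrite ler_norml lerNl -mulN1r -pairingZ//.
have bN := bounded_borelZ (-1) bf.
apply/andP; split; apply: le_pairing => // x; last exact: le_trans (ler_norm _) (fg x).
by rewrite mulN1r (le_trans _ (fg x))// -normrN ler_norm.
Qed.

Lemma le_dist_pairing mu f g h :
  bounded_borel f -> bounded_borel g -> bounded_borel h ->
  (forall x, `|f x - g x| <= h x) -> `|pairing mu f - pairing mu g| <= pairing mu h.
Proof.
move=> bf bg bh fgh; rewrite -pairingB//.
by apply: le_norm_pairing => //; exact: bounded_borelB.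
Qed.

Lemma BL_intro (M k : R) f : (forall x, `|f x| <= M) ->
  (forall x y, `|f x - f y| <= k * mdist x y) -> BL f.
Proof. by move=> fM fk; split; [apply/bounded_funE; exists M | exists k]. Qed.

Lemma BL_elim f : BL f -> exists (M k : R), [/\ 0 < k, (forall x, `|f x| <= M) &
  forall x y, `|f x - f y| <= k * mdist x y].
Proof.
move=> [/bounded_funE[M fM] [k fk]]; exists M, (`|k| + 1); split => //.
move=> x y; apply: le_trans (fk x y) _; rewrite ler_wpM2r ?mdist_ge0//.
by rewrite (le_trans (ler_norm _))// lerDl.
Qed.

Lemma BLD f g : BL f -> BL g -> BL (fun x => f x + g x).
Proof.
move=> /BL_elim[M [k [_ fM fk]]] /BL_elim[N [l [_ gN gl]]].
apply: (@BL_intro (M + N) (k + l)) => [x|x y].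
  by rewrite (le_trans (ler_normD _ _))// lerD.
by rewrite opprD addrACA (le_trans (ler_normD _ _))// mulrDl lerD.
Qed.

Lemma BL_unit_ball_lip f : BL f -> BL_norm f <= 1 ->
  forall x y, `|f x - f y| <= mdist x y.
Proof.
move=> BLf f1 x y; have [M [k [k0 fM fk]]] := BL_elim BLf.
have [->|xy] := eqVneq x y; first by rewrite subrr normr0 mdist_ge0.
rewrite -[leRHS]mul1r -ler_pdivrMr ?mdist_gt0//.
apply: le_trans f1; rewrite /BL_norm -[leLHS]add0r; apply: lerD.
  apply: le_trans (normr_ge0 (f point)) _; apply: sup_upper_bound; last by exists point.
  by split; [exists `|f point|, point | exists M => _ [z _ <-]].
apply: sup_upper_bound; last by exists (x, y) => //=; exact/eqP.
split; first by eexists; exists (x, y) => //=; exact/eqP.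
by exists k => _ [[a b] /= /eqP ab <-]; rewrite ler_pdivrMr ?mdist_gt0.
Qed.

Lemma pairing_BL_dist (M k : R) f mu nu : 0 < k -> (forall x, `|f x| <= M) ->
  (forall x y, `|f x - f y| <= k * mdist x y) ->
  `|pairing mu f - pairing nu f| <= (M + k) * BL_dist mu nu.
Proof.
move=> k0 fM fk; have BLf := BL_intro fM fk.
have D0 : 0 < M + k by rewrite ltr_wpDl// (le_trans _ (fM point)).
pose c := (M + k)^-1; have c0 : 0 < c by rewrite invr_gt0.
have cM x : `|c * f x| <= c * M by rewrite normrM (gtr0_norm c0) ler_pM2l.
have ck x y : `|c * f x - c * f y| <= c * k * mdist x y.
  by rewrite -mulrBr normrM (gtr0_norm c0) -mulrA ler_pM2l.
have cf1 : [set f | BL f /\ BL_norm f <= 1] (fun x => c * f x).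
  split; first exact: BL_intro cM ck.
  apply: le_trans (BL_norm_le _ cM ck) _; first by rewrite mulr_ge0// ltW.
  by rewrite -mulrDr mulVf// gt_eqF.
have := BL_dist_ub mu nu cf1; rewrite !pairingZ ?BL_bounded_borel//; try exact: BL_bounded_borel.
by rewrite -mulrBr normrM (gtr0_norm c0) mulrC ler_pdivrMr// mulrC.
Qed.

End pairing_calculus.

(** * Truncated distance to a finite set *)

Section truncated_distance.
Context {R : realType} {S : pmetricType R}.
Implicit Types (F : seq S) (x y : S) (mu : posmeas S).

(** Truncating the distance to [F] at 1 keeps it bounded, so that it is a test
    function itself, and gives a value to the empty set. *)
Definition dist1 F x : R := \big[Num.min/1]_(y <- F) mdist x y.

Lemma dist1_cons y F x : dist1 (y :: F) x = Num.min (mdist x y) (dist1 F x).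
Proof. by rewrite /dist1 big_cons. Qed.

Lemma dist1_ge0 F x : 0 <= dist1 F x.
Proof.
rewrite /dist1; elim/big_ind: _ => // [a b a0 b0|y _]; last exact: mdist_ge0.
by rewrite le_min a0.
Qed.

Lemma dist1_le1 F x : dist1 F x <= 1.
Proof.
elim: F => [|y F IH]; first by rewrite /dist1 big_nil.
by rewrite dist1_cons ge_min IH orbT.
Qed.

Lemma norm_dist1_le1 F x : `|dist1 F x| <= 1.
Proof. by rewrite ger0_norm ?dist1_ge0 ?dist1_le1. Qed.

Lemma dist1_cat F G x : dist1 (F ++ G) x = Num.min (dist1 F x) (dist1 G x).
Proof.
elim: F => [|y F IH] /=; last by rewrite !dist1_cons IH minA.
by rewrite {2}/dist1 big_nil min_r// dist1_le1.
Qed.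

Lemma dist1_le_mdist F x y : y \in F -> dist1 F x <= mdist x y.
Proof.
elim: F => // z F IH; rewrite inE dist1_cons ge_min => /predU1P[->|/IH ->].
  by rewrite lexx.
by rewrite orbT.
Qed.

Lemma dist1P F x :
  dist1 F x = 1 \/ exists2 y, y \in F & dist1 F x = mdist x y.
Proof.
elim: F => [|y F IH]; first by left; rewrite /dist1 big_nil.
rewrite dist1_cons; case: (leP (mdist x y) (dist1 F x)) => _.
  by right; exists y; rewrite ?mem_head.
case: IH => [->|[z zF ->]]; first by left.
by right; exists z => //; rewrite inE zF orbT.
Qed.

Lemma dist1_lip F x y : `|dist1 F x - dist1 F y| <= mdist x y.
Proof.
have half a b : dist1 F a - dist1 F b <= mdist a b.
  case: (dist1P F b) => [->|[z zF ->]].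
    by rewrite (le_trans _ (mdist_ge0 a b))// subr_le0 dist1_le1.
  rewrite lerBlDr (le_trans (dist1_le_mdist _ zF))//.
  exact: metric_triangle.
by rewrite ler_norml half andbT lerNl opprB metric_sym half.
Qed.

Lemma dist1_BL F : BL (dist1 F).
Proof.
apply: (@BL_intro _ _ 1 1); first exact: norm_dist1_le1.
by move=> x y; rewrite mul1r dist1_lip.
Qed.

(** A function controlled on [F] stays controlled near [F]: at distance less than
    1 the Lipschitz bound applies, further away the uniform bound 2 does. *)
Lemma le_dist1 (u : S -> R) (e : R) F : 0 <= e ->
  (forall x, `|u x| <= 2) -> (forall x y, `|u x - u y| <= 2 * mdist x y) ->
  (forall y, y \in F -> `|u y| <= e) -> forall x, `|u x| <= e + 2 * dist1 F x.
Proof.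
move=> e0 u2 ulip uF x; case: (dist1P F x) => [->|[y yF ->]].
  by rewrite mulr1 ler_wpDl.
rewrite -[u x](subrK (u y)) addrC (le_trans (ler_normD _ _))// lerD ?uF//.
Qed.

Hypothesis sepS : exists2 D : set S, countable D & dense D.

Lemma dense_sequence : exists s : nat -> S,
  forall x (e : R), 0 < e -> exists n, mdist x (s n) < e.
Proof.
have [D cD dD] := sepS.
have [D0|[s]] := pfcard_geP cD.
  have := dD setT; case; first by exists point.
    exact: openT.
  by rewrite D0 setI0 => x.
exists s => x e e0.
have [y [xy Dy]] : (ball x e)^° `&` D !=set0.
  apply: dD; last exact: open_interior.
  by exists x; exact: nbhsx_ballx.
have [n _ sn] : (s @` setT) y by exact: surj.
by exists n; rewrite sn; have := interior_subset xy; rewrite ballEmdist.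
Qed.

(** The substitute for tightness. Along an enumeration of a dense sequence the
    truncated distances to the first [n] points decrease to 0, so their integrals
    do as well by dominated convergence. *)
Lemma dist1_pairing_small mu (e : R) : 0 < e -> exists F, pairing mu (dist1 F) < e.
Proof.
move=> e0; have [s sd] := dense_sequence.
pose f n : borel S -> R := dist1 (mkseq s n).
have bf n : bounded_borel (f n) by exact/BL_bounded_borel/dist1_BL.
have cvgf x : (f n x)%:E @[n --> \oo] --> (0%:E : \bar R).
  apply: cvg_EFin; first exact: nearW.
  apply/cvgr0Pnorm_lt => r r0; have [m xm] := sd x r r0.
  near=> n; rewrite /= ger0_norm ?dist1_ge0// (le_lt_trans _ xm)//.
  apply: dist1_le_mdist; apply/mapP; exists m => //.
  by rewrite mem_iota/= add0n; near: n; exact: nbhs_infty_gt.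
have [] // := @dominated_convergence _ _ _ (posmeas_val mu) setT measurableT
     (fun n x => (f n x)%:E) (cst 0%E) (cst 1%E).
- by move=> n; apply/measurable_EFinP; exact: (bf n).1.
- by apply: aeW => x _; exact: cvgf.
- by apply: (@bounded_integrable _ _ mu (cst 1)) => //; exact: bounded_cst.
- by apply: aeW => x n _; rewrite lee_fin norm_dist1_le1.
move=> _ _; rewrite integral0 => /fine_cvgP[_] /cvgr0Pnorm_lt/(_ _ e0)[n _ /(_ n)/=].
move=> /(_ (leqnn n)) h; exists (mkseq s n).
exact: le_lt_trans (ler_norm _) h.
Unshelve. all: by end_near. Qed.

End truncated_distance.

(** * Finite nets of functions *)

Section finite_nets.
Context {R : realType} {T : choiceType}.

(** By induction on [F]: the value at the head of [F] lies in [-1, 1] and falls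
    into one of finitely many cells of length [e]; each cell, as a set of
    functions, has a net on the tail. *)
Lemma finite_net (F : seq T) (e : R) (B : set (T -> R)) : 0 < e ->
  (forall f x, B f -> `|f x| <= 1) ->
  exists l : seq (T -> R), (forall h, h \in l -> B h) /\
    forall f, B f -> exists2 h, h \in l & forall y, y \in F -> `|f y - h y| <= e.
Proof.
move=> e0; elim: F B => [|y F IH] B B1.
  have [[h Bh]|nB] := pselect (B !=set0); last first.
    by exists [::]; split=> // f Bf; exfalso; apply: nB; exists f.
  exists [:: h]; split=> [g|f Bf]; first by rewrite inE => /eqP ->.
  by exists h; rewrite ?mem_head.
pose C i : set (T -> R) :=
  [set f | B f /\ i%:R * e <= f y + 1 <= i.+1%:R * e].
have [l lC] := choice (fun i => IH (C i) (fun f x Cf => B1 f x Cf.1)).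
pose N := (Num.truncn (2 / e)).+1.
exists (flatten [seq l i | i <- iota 0 N]); split=> [h|f Bf].
  by move=> /flattenP[_ /mapP[i _ ->]] /((lC i).1 h) [].
have /andP[fy1 fy2] : -1 <= f y <= 1 by rewrite -ler_norml B1.
have fe0 : 0 <= (f y + 1) / e by rewrite divr_ge0 ?(ltW e0)//; lra.
pose i := Num.truncn ((f y + 1) / e).
have /andP[i1 i2] := truncn_itv fe0.
have Cf : C i f by split=> //; rewrite -ler_pdivlMr// i1/= -ler_pdivrMr// ltW.
have iN : (i < N)%N.
  rewrite -(ltr_nat R); apply: le_lt_trans i1 _.
  apply: le_lt_trans (truncnS_gt (2 / e)).
  by rewrite ler_pM2r ?invr_gt0//; lra.
have [h hl fh] := (lC i).2 f Cf; exists h.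
  by apply/flattenP; exists (l i) => //; apply/mapP; exists i; rewrite ?mem_iota.
move=> z; rewrite inE => /predU1P[->|]; last exact: fh.
have [_ /andP[h1 h2]] := (lC i).1 h hl; have [_ /andP[f1 f2]] := Cf.
rewrite -natr1 mulrDl mul1r in h2 f2.
by rewrite ler_norml; apply/andP; split; lra.
Qed.

End finite_nets.

Lemma near_all_in_seq (X : Type) (Fi : set_system X) {FF : Filter Fi} (T : eqType)
    (l : seq T) (Q : T -> X -> Prop) :
  (forall h, h \in l -> \forall n \near Fi, Q h n) ->
  \forall n \near Fi, forall h, h \in l -> Q h n.
Proof.
elim: l => [|h l IH] lQ; first exact: nearW.
have Ql : \forall n \near Fi, forall k, k \in l -> Q k n.
  by apply: IH => k kl; apply: lQ; rewrite inE kl orbT.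
apply: filterS2 (lQ h (mem_head _ _)) Ql => n Qh Qk k.
by rewrite inE => /predU1P[->//|]; exact: Qk.
Qed.

(** * The Schur property of the dual bounded Lipschitz norm *)

Section soft_threshold.
Context {R : realFieldType}.
Implicit Types b s t : R.

(** Subtracting from [t] its projection onto the interval from [-b] to [b] annihilates
    small values without increasing Lipschitz constants. *)
Definition soft_threshold b t := t - Num.max (- b) (Num.min b t).

Lemma soft_threshold_dist b t : 0 <= b -> `|t - soft_threshold b t| <= b.
Proof.
move=> b0; rewrite /soft_threshold opprB addrC subrK ler_norml.
by rewrite le_max lexx/= ge_max ge_min lexx/= andbT; lra.
Qed.

Lemma soft_threshold_eq0 b t : `|t| <= b -> soft_threshold b t = 0.
Proof.
rewrite ler_norml => /andP[t1 t2]; rewrite /soft_threshold.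
by rewrite (min_r t2) (max_r t1) subrr.
Qed.

Lemma soft_threshold_lip b s t : 0 <= b ->
  `|soft_threshold b s - soft_threshold b t| <= `|s - t|.
Proof.
move=> b0; have half p q : q <= p ->
    `|soft_threshold b p - soft_threshold b q| <= p - q.
  move=> qp; rewrite /soft_threshold ler_norml; apply/andP.
  by split; case: (leP b p) => bp; case: (leP b q) => bq;
    case: (leP (- b)) => h1; try lra; case: (leP (- b)) => h2; lra.
have [ts|/ltW st] := leP t s; first by rewrite (ger0_norm (_ : 0 <= s - t)) ?subr_ge0 ?half.
by rewrite distrC [leRHS]distrC (ger0_norm (_ : 0 <= t - s)) ?subr_ge0 ?half.
Qed.

Lemma soft_threshold_le b t : 0 <= b -> `|soft_threshold b t| <= `|t|.
Proof.
move=> b0; have := soft_threshold_lip t 0 b0.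
by rewrite (@soft_threshold_eq0 b 0) ?normr0// !subr0.
Qed.

End soft_threshold.

Section schur_step.
Context {R : realType} {S : pmetricType R}.
Hypothesis sepS : exists2 D : set S, countable D & dense D.
Implicit Types (mu nu : posmeas S) (F : seq S).

(** One step of the gliding hump. Soft thresholding makes [u] vanish near [F] at the
    cost [b] per unit of mass; multiplying by a cutoff that is 1 on a finite set
    [F'] and 0 at distance [a] from it costs at most [2 / a] times the integral
    of the truncated distance to [F'], which is as small as desired once [F'] is large. *)
Lemma localize_test_function mu nu F (u : S -> R) (a b r : R) : 0 < a -> 0 <= b -> 0 < r ->
  (forall x, `|u x| <= 2) -> (forall x y, `|u x - u y| <= 2 * mdist x y) ->
  (forall x, dist1 F x < a -> `|u x| <= b) ->
  exists (g : S -> R) (F' : seq S),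
    [/\ forall x, dist1 F' x <= dist1 F x,
        pairing mu (dist1 F') + pairing nu (dist1 F') <= r,
        [/\ forall x, `|g x| <= 2,
            forall x y, `|g x - g y| <= (2 + 2 / a) * mdist x y,
            forall x, dist1 F x < a -> g x = 0 &
            forall x, a <= dist1 F' x -> g x = 0] &
        `|pairing mu u - pairing nu u| <=
          `|pairing mu g - pairing nu g| + (b * (mass mu + mass nu) + 2 / a * r)].
Proof.
move=> a0 b0 r0 u2 ulip ub; have r20 : 0 < r / 2 by rewrite divr_gt0.
have [F1 F1r] := dist1_pairing_small sepS mu r20.
have [F2 F2r] := dist1_pairing_small sepS nu r20.
pose F' := F ++ F1 ++ F2.
have bd G : bounded_borel (dist1 G) by exact/BL_bounded_borel/dist1_BL.
have F'r : pairing mu (dist1 F') + pairing nu (dist1 F') <= r.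
  rewrite [leRHS]splitr lerD//.
    apply: le_trans (ltW F1r); apply: le_pairing => // x.
    by rewrite !dist1_cat !ge_min lexx !orbT.
  apply: le_trans (ltW F2r); apply: le_pairing => // x.
  by rewrite !dist1_cat !ge_min lexx !orbT.
pose chi x := Num.max 0 (1 - dist1 F' x / a).
have chi01 x : 0 <= chi x <= 1.
  rewrite /chi le_max lexx/= ge_max ler01/= lerBlDr lerDl.
  by rewrite divr_ge0// ?dist1_ge0// ltW.
have chi1 x : 1 - chi x <= dist1 F' x / a.
  by rewrite lerBlDr -lerBlDl /chi le_max lexx orbT.
have chilip x y : `|chi x - chi y| <= a^-1 * mdist x y.
  apply: le_trans (_ : `|dist1 F' x / a - dist1 F' y / a| <= _); last first.
    rewrite -mulrBl normrM (gtr0_norm (_ : 0 < a^-1)) ?invr_gt0// mulrC.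
    by rewrite ler_pM2l ?invr_gt0// dist1_lip.
  rewrite /chi; move: (dist1 F' x / a) (dist1 F' y / a) => p q.
  case: (leP 0 (1 - p)) => h1; case: (leP 0 (1 - q)) => h2.
  - by rewrite opprB addrC addrA subrK distrC.
  - by rewrite ler_normr; apply/orP; right; rewrite ger0_norm; lra.
  - by rewrite ler_normr; apply/orP; left; rewrite ler0_norm; lra.
  - by rewrite subrr normr0.
pose v x := soft_threshold b (u x).
have v2 x : `|v x| <= 2 by rewrite (le_trans (soft_threshold_le _ b0)).
have vlip x y : `|v x - v y| <= 2 * mdist x y.
  by rewrite (le_trans (soft_threshold_lip _ _ b0)).
pose g x := chi x * v x.
have g2 x : `|g x| <= 2.
  have /andP[c0 c1] := chi01 x.
  by rewrite normrM (ger0_norm c0) -[leRHS]mul1r ler_pM.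
have glip x y : `|g x - g y| <= (2 + 2 / a) * mdist x y.
  have -> : g x - g y = chi x * (v x - v y) + (chi x - chi y) * v y.
    by rewrite /g; ring.
  rewrite (le_trans (ler_normD _ _))// [leRHS]mulrDl; have /andP[c0 c1] := chi01 x.
  rewrite !normrM lerD//.
    by rewrite (ger0_norm c0) -[leRHS]mul1r ler_pM.
  by rewrite mulrC -mulrA ler_pM.
exists g, F'; split=> //.
- by move=> x; rewrite dist1_cat ge_min lexx.
- split=> // x.
    by move=> /ub ux; rewrite /g /v soft_threshold_eq0// mulr0.
  move=> ax; rewrite /g /chi max_l ?mul0r// subr_le0.
  by rewrite ler_pdivlMr// mul1r.
have bu : bounded_borel u by apply: BL_bounded_borel; exact: BL_intro u2 ulip.
have bg : bounded_borel g by apply: BL_bounded_borel; exact: BL_intro g2 glip.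
have bh : bounded_borel (fun x => b + 2 / a * dist1 F' x).
  by apply: bounded_borelD; [exact: bounded_borel_cst|exact: bounded_borelZ].
have ug x : `|u x - g x| <= b + 2 / a * dist1 F' x.
  rewrite -[u x](subrK (v x)) -addrA (le_trans (ler_normD _ _))// lerD//.
    exact: soft_threshold_dist.
  have -> : v x - g x = (1 - chi x) * v x by rewrite /g; ring.
  have /andP[c0 c1] := chi01 x.
  rewrite normrM ger0_norm ?subr_ge0// mulrC -mulrA [_^-1 * _]mulrC.
  by rewrite ler_pM ?subr_ge0.
have dm (m : posmeas S) : `|pairing m u - pairing m g| <= b * mass m + 2 / a * pairing m (dist1 F').
  have := le_dist_pairing m bu bg bh ug.
  move/le_trans; apply.
  rewrite pairingD//; first by rewrite pairingZ// (pairing_cst m b).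
    exact: bounded_borel_cst.
  exact: bounded_borelZ.
have -> : pairing mu u - pairing nu u = (pairing mu g - pairing nu g) +
  ((pairing mu u - pairing mu g) - (pairing nu u - pairing nu g)) by ring.
rewrite (le_trans (ler_normD _ _))// lerD2l (le_trans (ler_normB _ _))//.
apply: le_trans (lerD (dm mu) (dm nu)) _.
rewrite mulrDr addrACA lerD2l -mulrDr ler_wpM2l// divr_ge0// ltW//.
Qed.

End schur_step.
Section schur_property.
Context {R : realType} {S : pmetricType R}.
Hypothesis sepS : exists2 D : set S, countable D & dense D.

(** Gliding hump: a failure of norm convergence would yield humps [g k] with
    disjoint supports whose sum [f] keeps a discrepancy at least [c] for infinitely
    many [n]. For the [k]-th index, the earlier humps contribute little since
    they form one fixed test function, and the later ones contribute little
    since they vanish near the finite set that carries most of the mass. *)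
Theorem schur_property (al be : nat -> posmeas S) (M : R) :
  (forall n, mass (al n) + mass (be n) <= M) ->
  (forall f, BL f -> pairing (al n) f - pairing (be n) f @[n --> \oo] --> (0 : R)) ->
  BL_dist (al n) (be n) @[n --> \oo] --> (0 : R).
Proof.
move=> massM tau0; pose tau n f := pairing (al n) f - pairing (be n) f.
have tau_small f c : BL f -> 0 < c -> \forall n \near \oo, `|tau n f| < c.
  by move=> /tau0/cvgr0Pnorm_lt; exact.
apply: contrapT => /cvgr0Pnorm_lt ncv.
have [e e0 frequent] : exists2 e : R, 0 < e & forall N : nat,
    exists2 n, (N <= n)%N & e <= BL_dist (al n) (be n).
  apply: contrapT => nfreq; apply: ncv => e e0; apply: contrapT => nne.
  apply: nfreq; exists e => // N; apply: contrapT => nN; apply: nne.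
  exists N => // n /= Nn; rewrite ger0_norm; last exact: (@mdist_ge0 R (posmeas_BL S)).
  by rewrite ltNge; apply/negP => en; apply: nN; exists n.
have M0 : 0 <= M by rewrite (le_trans _ (massM 0%N))// addr_ge0// mass_ge0.
(* The budget: a test function with discrepancy above [5 * c] loses at most [c] to the
   net element, [c / 2] to the threshold [3 * a] and [c / 2] to the cutoff, which
   leaves humps worth [3 * c]; the other humps then spoil at most [c + c / 2]. *)
pose c := e / 6; have c0 : 0 < c by rewrite divr_gt0.
pose a := c / (6 * (M + 1)).
have a0 : 0 < a by rewrite divr_gt0// mulr_gt0// ltr_wpDl.
pose r := a * c / 4; have r0 : 0 < r by rewrite divr_gt0// mulr_gt0.
have aM : 3 * a * M <= c / 2.
  have -> : c / 2 = 3 * a * (M + 1) by rewrite /a; field; rewrite gt_eqF// ltr_wpDl.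
  by rewrite ler_wpM2l ?lerDl// mulr_ge0// ltW.
have ar : 2 / a * r = c / 2 by rewrite /r; field; rewrite gt_eqF.
have step (s : (seq S * (S -> R)) * nat) :
    exists t : (nat * (S -> R)) * seq S, BL s.1.2 ->
    let: ((F, G), N) := s in let: ((n, g), F') := t in
    [/\ (N <= n)%N, `|tau n G| < c, 3 * c <= `|tau n g|,
        pairing (al n) (dist1 F') + pairing (be n) (dist1 F') <= r &
       [/\ forall x, dist1 F' x <= dist1 F x,
           forall x, `|g x| <= 2,
           forall x y, `|g x - g y| <= (2 + 2 / a) * mdist x y,
           forall x, dist1 F x < a -> g x = 0 &
           forall x, a <= dist1 F' x -> g x = 0]].
  case: s => [[F G] N] /=.
  have [BLG|nBLG] := pselect (BL G); last by exists ((0%N, cst 0), F).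
  have [l [lB lnet]] := @finite_net R S F a [set f | BL f /\ BL_norm f <= 1]
    a0 (fun f x f1 => unit_ball_le1 f1 x).
  have [N1 _ N1P] : \forall n \near \oo, forall h, h \in l -> `|tau n h| < c.
    by apply: near_all_in_seq => h /lB[BLh _]; exact: tau_small.
  have [N2 _ N2P] := tau_small G c BLG c0.
  have [n Nn en] := frequent (maxn N (maxn N1 N2)).
  move: Nn; rewrite !geq_max => /and3P[Nn N1n N2n].
  have [_ [f [BLf f1] <-] tauf] : exists2 y : R,
      [set `|tau n f| | f in [set f | BL f /\ BL_norm f <= 1]] y & 5 * c < y.
    apply: sup_gt; first exact: (BL_dist_has_sup (al n) (be n)).1.
    by rewrite -BL_distE (lt_le_trans _ en)// /c; lra.
  have [h hl fh] := lnet f (conj BLf f1).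
  have [BLh h1] := lB h hl.
  have le1 k x : BL k -> BL_norm k <= 1 -> `|k x| <= 1.
    by move=> BLk k1; exact: (unit_ball_le1 (conj BLk k1)).
  pose u x := f x - h x.
  have u2 x : `|u x| <= 2.
    by rewrite (le_trans (ler_normB _ _))// (_ : 2 = 1 + 1)// lerD// le1.
  have ulip x y : `|u x - u y| <= 2 * mdist x y.
    have -> : u x - u y = (f x - f y) - (h x - h y) by rewrite /u; ring.
    rewrite (_ : 2 = 1 + 1)// mulrDl mul1r (le_trans (ler_normB _ _))//.
    by rewrite lerD// BL_unit_ball_lip.
  have ub x : dist1 F x < a -> `|u x| <= 3 * a.
    move=> xa; apply: le_trans (le_dist1 (ltW a0) u2 ulip fh x) _.
    by move/ltW in xa; lra.
  have a30 : 0 <= 3 * a by rewrite mulr_ge0// ltW.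
  have [g [F' [FF' F'r [g2 glip gF gF'] taug]]] :=
    localize_test_function sepS (al n) (be n) a0 a30 r0 u2 ulip ub.
  exists ((n, g), F') => _; split=> //; first exact: N2P.
  have bf := BL_bounded_borel BLf; have bh := BL_bounded_borel BLh.
  have tauu : pairing (al n) u - pairing (be n) u = tau n f - tau n h.
    by rewrite /u !pairingB// /tau; ring.
  move: taug; rewrite tauu ar -/(tau n g) => taug.
  have := N1P n N1n h hl; have := lerB_dist (tau n f) (tau n h).
  have : 3 * a * (mass (al n) + mass (be n)) <= c / 2.
    by apply: le_trans aM; rewrite ler_wpM2l.
  move: tauf taug; lra.
(* A state is a finite set together with the sum of the humps built so far. *)
have [phi phiP] := choice step.
pose st := fix st k := if k is k'.+1 then
    let t := phi (st k', k') in (t.2, fun x => (st k').2 x + t.1.2 x)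
  else ([::] : seq S, cst 0 : S -> R).
pose n_ k := (phi (st k, k)).1.1.
pose g k := (phi (st k, k)).1.2.
pose F k := (st k).1; pose G k := (st k).2.
have GS k x : G k.+1 x = G k x + g k x by [].
have humps k : BL (G k) -> [/\ (k <= n_ k)%N, `|tau (n_ k) (G k)| < c,
      3 * c <= `|tau (n_ k) (g k)|,
      pairing (al (n_ k)) (dist1 (F k.+1)) + pairing (be (n_ k)) (dist1 (F k.+1)) <= r &
     [/\ forall x, dist1 (F k.+1) x <= dist1 (F k) x,
         forall x, `|g k x| <= 2,
         forall x y, `|g k x - g k y| <= (2 + 2 / a) * mdist x y,
         forall x, dist1 (F k) x < a -> g k x = 0 &
         forall x, a <= dist1 (F k.+1) x -> g k x = 0]].
  move=> BLG; have := phiP (st k, k) BLG; rewrite /n_ /g /F /G /=.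
  by case: (phi _) => [[n g'] F']; case: (st k).
have BLG k : BL (G k).
  elim: k => [|k IH]; first exact: (unit_ball0 S).1.
  apply: BLD => //; have [_ _ _ _ [_ g2 glip _ _]] := humps k IH.
  exact: BL_intro g2 glip.
have {}humps k := humps k (BLG k).
have Fmono x i j : (i <= j)%N -> dist1 (F j) x <= dist1 (F i) x.
  elim: j => [|j IH]; first by rewrite leqn0 => /eqP ->.
  rewrite leq_eqVlt => /predU1P[->//|/IH]; apply: le_trans.
  by have [_ _ _ _ [->]] := humps j.
(* Disjoint supports: the points where [g k] lives are within [a] of [F k.+1] but
   not of [F k]. *)
have active x : exists k, forall j, j <> k -> g j x = 0.
  have [[k gk]|ng] := pselect (exists k, g k x <> 0); last first.
    by exists 0%N => j _; apply: contrapT => gj; apply: ng; exists j.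
  have disj i j : (i < j)%N -> g i x <> 0 -> g j x = 0.
    move=> ij gi; have [_ _ _ _ [_ _ _ + _]] := humps j; apply.
    apply: le_lt_trans (Fmono x _ _ ij) _; rewrite ltNge; apply/negP => ai.
    by apply: gi; have [_ _ _ _ [_ _ _ _]] := humps i; exact.
  exists k => j jk; apply: contrapT => gj.
  have [kj|kj|kj] := ltngtP k j.
  - by apply: gj; exact: disj kj gk.
  - by apply: gk; exact: disj kj gj.
  - exact/jk/esym.
(* [f] is the pointwise sum of all humps: [kappa x] is the only index that can
   contribute at [x]. *)
have [kappa kappaP] := choice active.
pose f x := g (kappa x) x.
have Gf k x : G k x = if (kappa x < k)%N then f x else 0.
  elim: k => [//|k IH]; rewrite GS IH ltnS.
  have [<-|kx] := eqVneq (kappa x) k; first by rewrite ltnn leqnn add0r.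
  rewrite (kappaP x k); last by apply/eqP; rewrite eq_sym.
  by rewrite addr0 [(kappa x <= k)%N]leq_eqVlt (negPf kx).
have L0 : 0 < 2 + 2 / a by rewrite addr_gt0// divr_gt0.
have f2 x : `|f x| <= 2 by have [_ _ _ _ [_ ->]] := humps (kappa x).
have BLf : BL f.
  apply: (@BL_intro _ _ 2 (2 * (2 + 2 / a)) f f2) => x y; rewrite /f.
  set i := kappa x; set j := kappa y.
  have lip k : `|g k x - g k y| <= (2 + 2 / a) * mdist x y.
    by have [_ _ _ _ [_ _ ->]] := humps k.
  have [ij|/eqP ij] := eqVneq i j.
    rewrite -ij (le_trans (lip i))// -mulrA ler_peMl// ?ler1n//.
    by rewrite mulr_ge0 ?mdist_ge0// ltW.
  (* Since [g i y = g j x = 0], both differences are increments of a single hump. *)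
  have -> : g i x - g j y = (g i x - g i y) + (g j x - g j y).
    by rewrite (kappaP y i ij) (kappaP x j (nesym ij)); ring.
  apply: le_trans (ler_normD _ _) _; apply: le_trans (lerD (lip i) (lip j)) _.
  by rewrite -mulrA; move: (_ * mdist x y) => z; lra.
have [N _ Nsmall] := tau_small f c BLf c0.
have [Nn tauG taug F'r [_ g2 glip _ _]] := humps N.
have := Nsmall _ Nn; apply/negP; rewrite -leNgt.
have bg : bounded_borel (g N) by apply: BL_bounded_borel; exact: BL_intro g2 glip.
have bG k := BL_bounded_borel (BLG k).
have bd : bounded_borel (fun x => 2 / a * dist1 (F N.+1) x).
  by apply/bounded_borelZ/BL_bounded_borel/dist1_BL.
(* The humps after the [N]-th are bounded by 2 and vanish within [a] of [F N.+1],
   where almost all the mass of index [n_ N] lies. *)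
have tail x : `|f x - G N.+1 x| <= 2 / a * dist1 (F N.+1) x.
  have d0 : 0 <= 2 / a * dist1 (F N.+1) x.
    by rewrite mulr_ge0// ?dist1_ge0// divr_ge0// ltW.
  rewrite Gf; case: ltnP => kx; first by rewrite subrr normr0.
  rewrite subr0; have [xa|ax] := ltP (dist1 (F N.+1) x) a.
    have [_ _ _ _ [_ _ _ + _]] := humps (kappa x); rewrite /f => ->.
      by rewrite normr0.
    exact: le_lt_trans (Fmono x _ _ kx) xa.
  by rewrite (le_trans (f2 x))// mulrAC ler_pdivlMr// ler_pM2l.
have bf := BL_bounded_borel BLf.
have tm (m : posmeas S) : `|pairing m f - (pairing m (G N) + pairing m (g N))| <=
    2 / a * pairing m (dist1 (F N.+1)).
  rewrite -(pairingD m (bG N) bg) -(pairingZ m _ (BL_bounded_borel (dist1_BL _))).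
  exact: (le_dist_pairing m bf (bounded_borelD (bG N) bg) bd tail).
have : `|tau (n_ N) f - (tau (n_ N) (G N) + tau (n_ N) (g N))| <= c / 2.
  rewrite -ar (le_trans _ (_ : 2 / a * (pairing (al (n_ N)) (dist1 (F N.+1)) +
    pairing (be (n_ N)) (dist1 (F N.+1))) <= _))//; last first.
    by rewrite ler_wpM2l// divr_ge0// ltW.
  rewrite mulrDr (le_trans _ (lerD (tm _) (tm _)))// (le_trans _ (ler_normB _ _))//.
  by rewrite le_eqVlt; apply/orP; left; apply/eqP; congr `| _ |; rewrite /tau; ring.
move: (tau (n_ N) f) (tau (n_ N) (G N)) (tau (n_ N) (g N)) tauG taug => p q s.
rewrite ltr_norml => /andP[q1 q2] s3; rewrite ler_norml => /andP[p1 p2].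
move: s3; rewrite !ler_normr => /orP[s3|s3]; apply/orP; [left|right]; lra.
Qed.

End schur_property.

(** * Equicontinuous families as test functions *)

Section upper_envelope.
Context {R : realType} {S : pmetricType R}.
Implicit Types (h : S -> R) (k M : R) (mu nu : posmeas S).

(** A sup-convolution: for bounded [h], the least [k]-Lipschitz function above [h]. *)
Definition upper_envelope k h (x : S) : R :=
  sup [set h y - k * mdist x y | y in [set: S]].

Section properties.
Variables (k M : R) (h : S -> R).
Hypotheses (k0 : 0 <= k) (hM : forall x, `|h x| <= M).

Let envelope_has_sup x : has_sup [set h y - k * mdist x y | y in [set: S]].
Proof.
split; first by exists (h x - k * mdist x x), x.
exists M => _ [y _ <-]; rewrite lerBlDr (le_trans (le_trans (ler_norm _) (hM y)))//.
by rewrite lerDl mulr_ge0// mdist_ge0.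
Qed.

Lemma upper_envelope_ub x y : h y - k * mdist x y <= upper_envelope k h x.
Proof. by apply: sup_upper_bound; [exact: envelope_has_sup | exists y]. Qed.

Lemma upper_envelope_ge x : h x <= upper_envelope k h x.
Proof. by have := upper_envelope_ub x x; rewrite mdistxx mulr0 subr0. Qed.

Lemma upper_envelope_le x (c : R) :
  (forall y, h y <= c + k * mdist x y) -> upper_envelope k h x <= c.
Proof.
move=> hc; apply: ge_sup; first exact: (envelope_has_sup x).1.
by move=> _ [y _ <-]; rewrite lerBlDr.
Qed.

Lemma norm_upper_envelope x : `|upper_envelope k h x| <= M.
Proof.
have /andP[hx _] : - M <= h x <= M by rewrite -ler_norml.
rewrite ler_norml (le_trans hx (upper_envelope_ge x))/=.
apply: upper_envelope_le => y; apply: le_trans (le_trans (ler_norm _) (hM y)) _.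
by rewrite lerDl mulr_ge0// mdist_ge0.
Qed.

Lemma upper_envelope_lip x y :
  `|upper_envelope k h x - upper_envelope k h y| <= k * mdist x y.
Proof.
have half a b : upper_envelope k h a - upper_envelope k h b <= k * mdist a b.
  rewrite lerBlDr; apply: upper_envelope_le => z.
  have := upper_envelope_ub b z; have := ler_wpM2l k0 (metric_triangle b a z).
  by rewrite mulrDr (metric_sym b a); lra.
by rewrite ler_norml half andbT lerNl opprB metric_sym half.
Qed.

End properties.

(** Replacing [h] by its envelope increases the integral against [mu], so that only
    [nu] has to absorb the gap between the two; the gap is at most [e] on [E]
    and at most [2 * M] elsewhere. *)
Lemma pairing_le_envelope mu nu h (E : set (borel S)) (k M e : R) :
  0 < k -> 0 <= e -> measurable E ->
  bounded_borel h -> (forall x, `|h x| <= M) ->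
  (forall x y, E x -> h y <= h x + e + k * mdist x y) ->
  pairing mu h - pairing nu h <= (M + k) * BL_dist mu nu +
    (e * mass nu + 2 * M * fine (nu (~` E))).
Proof.
move=> k0 e0 mE bh hM hE; pose w := upper_envelope k h.
have wM x : `|w x| <= M by exact: norm_upper_envelope (ltW k0) hM x.
have wlip x y : `|w x - w y| <= k * mdist x y.
  exact: (upper_envelope_lip (ltW k0) hM).
have bw := BL_bounded_borel (BL_intro wM wlip).
have mwh : pairing mu h <= pairing mu w.
  by apply: le_pairing => // x; exact: upper_envelope_ge (ltW k0) hM x.
have mnu := le_trans (ler_norm _) (pairing_BL_dist mu nu k0 wM wlip).
have bi : bounded_borel (\1_(~` E) : borel S -> R).
  exact/bounded_borel_indic/measurableC.
have bi' : bounded_borel (fun x => 2 * M * (\1_(~` E) : borel S -> R) x).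
  exact: bounded_borelZ.
have nwh : pairing nu w - pairing nu h <=
    e * mass nu + 2 * M * fine (nu (~` E)).
  rewrite -pairingB// -[fine (nu (~` E))]pairing_indic; last exact: measurableC.
  rewrite -pairingZ// -(pairing_cst nu e) -pairingD//; last exact: bounded_borel_cst.
  apply: le_pairing.
  - exact: bounded_borelB.
  - by apply: bounded_borelD => //; exact: bounded_borel_cst.
  move=> x /=; have [Ex|nEx] := pselect (E x); rewrite indicE.
    rewrite memNset ?mulr0 ?addr0//=.
    rewrite lerBlDr [leRHS]addrC; apply: (upper_envelope_le (ltW k0) hM) => y.
    exact: hE.
  rewrite mem_set//= mulr1 (le_trans (ler_norm _))// (le_trans (ler_normB _ _))//.
  by have := wM x; have := hM x; lra.
by lra.
Qed.

End upper_envelope.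

Lemma equicontinuous_continuous {R : realType} {T : topologicalType}
    {S' : metricType R} {I : Type} (F : I -> T -> S') :
  (forall t, equicontinuous_at F t) -> forall i, continuous (F i).
Proof.
move=> ecF i t; apply/metricType_numDomainType.cvgrPdist_lt => e e0.
have [A oA AF] := ecF t e e0.
by apply: filterS (open_nbhs_nbhs oA) => u Au; rewrite metric_sym AF.
Qed.

Section equicontinuous_tests.
Context {R : realType} {S : pmetricType R} {I : Type}.
Variables (h : I -> S -> R^o) (M : R).
Hypothesis ech : forall x, equicontinuous_at h x.
Hypothesis hM : forall i x, `|h i x| <= M.

Lemma equicontinuous_near (x : S) (e : R) : 0 < e ->
  exists2 r : R, 0 < r & forall i y, mdist x y < r -> `|h i y - h i x| < e.
Proof.
move=> /(ech x)[A [oA Ax] hA]; have /nbhs_ballP[r /= r0 rA] := open_nbhs_nbhs (conj oA Ax).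
exists r => // i y xy; rewrite distrC; apply: (hA i y); apply: rA.
by rewrite ballEmdist.
Qed.

(** The points where all envelopes of the family with constant [n.+1] are within [e]
    of the functions themselves, phrased without suprema: this makes the set
    visibly closed and increasing in [n]. *)
Let good (e : R) (n : nat) : set S :=
  [set x | forall i y, `|h i y - h i x| <= e + n.+1%:R * mdist x y].

Let good_closed e n : closed (good e n).
Proof.
have -> : good e n = \bigcap_(p in [set: I * S])
    [set x | `|h p.1 p.2 - h p.1 x| <= e + n.+1%:R * mdist x p.2].
  apply/seteqP; split=> [x gx [i y] _|x gx i y]; first exact: gx.
  exact: (gx (i, y)).
apply: closed_bigI => -[i y] _ /=.
(* Each condition is closed since both sides are continuous in [x]. *)
pose phi x : R^o := e + n.+1%:R * mdist x y - `|h i y - h i x|.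
have -> : [set x | `|h i y - h i x| <= e + n.+1%:R * mdist x y] =
    phi @^-1` [set r | 0 <= r].
  by apply/seteqP; split=> x /=; rewrite subr_ge0.
apply: preimage_closed; last exact: closed_ge.
move=> x _; apply: cvgB.
  apply: cvgD; first exact: cvg_cst.
  apply: cvgM; first exact: cvg_cst.
  apply: (@lipschitz_continuous _ _ (fun x => mdist x y)).
  have half a b : mdist a y - mdist b y <= mdist a b.
    by rewrite lerBlDr metric_triangle.
  exists 1 => a b; rewrite mul1r ler_norml half andbT lerNl opprB.
  by rewrite [leRHS]metric_sym half.
apply: cvg_norm; apply: cvgB; first exact: cvg_cst.
exact: (equicontinuous_continuous ech).
Qed.

Let good_measurable e n : measurable (good e n : set (borel S)).
Proof.
rewrite -[good e n]setCK; apply: measurableC; apply: sub_sigma_algebra.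
by apply: closed_openC; exact: good_closed.
Qed.

Let good_exhausts e mu : 0 < e ->
  fine (posmeas_val mu (~` good e n : set (borel S))) @[n --> \oo] --> (0 : R).
Proof.
move=> e0.
have cap0 : \bigcap_n ~` good e n = set0.
  apply/seteqP; split=> // x gx.
  have [r r0 hr] := equicontinuous_near x e0.
  (* Beyond distance [r] the slope [n.+1] already exceeds the oscillation [2 * M]. *)
  pose n := Num.truncn (2 * M / r).
  apply: (gx n) => // i y; have [xy|xy] := ltP (mdist x y) r.
    by rewrite (le_trans (ltW (hr i y xy)))// lerDl mulr_ge0// mdist_ge0.
  rewrite (le_trans (ler_normB _ _))//.
  apply: le_trans (_ : 2 * M <= _); first by have := hM i y; have := hM i x; lra.
  apply: le_trans (_ : n.+1%:R * r <= _).
    by rewrite -ler_pdivrMr// ltW// truncnS_gt.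
  by rewrite ler_wpDl// ?(ltW e0)// ler_pM2l.
have := @nonincreasing_cvg_mu _ _ _ (posmeas_val mu) (fun n => ~` good e n).
rewrite cap0 measure0 => cv.
have /fine_cvgP[_] : posmeas_val mu (~` good e n : set (borel S)) @[n --> \oo] --> 0%:E.
  apply: cv.
  - by rewrite -ge0_fin_numE// fin_num_measure//; apply: measurableC.
  - by move=> n; apply: measurableC.
  - exact: measurable0.
  - move=> n m nm; apply/subsetPset; apply: subsetC => x gx i y.
    rewrite (le_trans (gx i y))// lerD2l ler_wpM2r ?mdist_ge0//.
    by rewrite ler_nat ltnS.
exact.
Qed.

(** For one [n] the good set misses little [mu]-mass, and the comparison with the
    envelopes then holds for all members of the family at once. It is one-sided,
    hence used for [h i] and for [- h i]. *)
Theorem equicontinuous_tests_uniform (mu : posmeas S) (e : R) : 0 < e ->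
  exists2 d : R, 0 < d & forall nu, BL_dist nu mu < d ->
    forall i, `|pairing nu (h i) - pairing mu (h i)| < e.
Proof.
move=> e0; have [[i0 _]|noI] := pselect (exists i : I, True); last first.
  by exists 1 => // nu _ i; exfalso; apply: noI; exists i.
have M0 : 0 <= M by exact: le_trans (hM i0 point).
pose m := mass mu; have m0 : 0 <= m by exact: mass_ge0.
pose e1 := e / (4 * (m + 1)).
have e10 : 0 < e1 by rewrite divr_gt0// mulr_gt0// ltr_wpDl.
have e2 : 0 < e / (8 * (M + 1)) by rewrite divr_gt0// mulr_gt0// ltr_wpDl.
have /cvgr0Pnorm_lt/(_ _ e2)[n _ /(_ n (leqnn n))] := good_exhausts mu e10.
rewrite /= ger0_norm ?fine_ge0// => small.
have k0 : (0 : R) < n.+1%:R by [].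
exists (e / (4 * (M + n.+1%:R))) => [|nu nud i].
  by rewrite divr_gt0// mulr_gt0// ltr_wpDl.
have part1 : (M + n.+1%:R) * BL_dist nu mu < e / 4.
  have -> : e / 4 = (M + n.+1%:R) * (e / (4 * (M + n.+1%:R))).
    by field; rewrite gt_eqF// ltr_wpDl.
  by rewrite ltr_pM2l// ltr_wpDl.
have part2 : e1 * m <= e / 4.
  have -> : e / 4 = e1 * (m + 1) by rewrite /e1; field; rewrite gt_eqF// ltr_wpDl.
  by rewrite ler_pM2l// lerDl.
have part3 : 2 * M * fine (mu (~` good e1 n)) <= e / 4.
  have -> : e / 4 = 2 * (M + 1) * (e / (8 * (M + 1))).
    by field; rewrite gt_eqF// ltr_wpDl.
  rewrite -!mulrA ler_pM2l//.
  by rewrite ler_pM ?fine_ge0//; [rewrite lerDl | exact: ltW].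
have bb (s : R) : bounded_borel (fun x => s * h i x).
  apply: bounded_borelZ; split.
    by apply: continuous_borel; exact: (equicontinuous_continuous ech).
  by apply/bounded_funE; exists M; exact: hM.
have sided (s : R) : `|s| = 1 ->
    s * (pairing nu (h i) - pairing mu (h i)) <= 3 / 4 * e.
  move=> s1; have bh : bounded_borel (h i).
    have -> : h i = (fun x => 1 * h i x) by apply/funext => x; rewrite mul1r.
    exact: bb.
  rewrite mulrBr -!pairingZ//.
  apply: le_trans (@pairing_le_envelope _ _ nu mu _ (good e1 n) _ M e1 k0 (ltW e10)
    (good_measurable e1 n) (bb s) _ _) _; last by rewrite -/m; lra.
  - by move=> x; rewrite normrM s1 mul1r.
  - move=> x y gx; rewrite -addrA -lerBlDl -mulrBr.
    by rewrite (le_trans (ler_norm _))// normrM s1 mul1r; exact: gx.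
have := sided 1 (normr1 _); have := sided (-1) (normrN1 _).
rewrite mulN1r mul1r ltr_norml; lra.
Qed.

End equicontinuous_tests.

(** * The weak topology on probability measures *)

Section weak_topology.
Context {R : realType} {S : pmetricType R}.
Hypothesis sepS : exists2 D : set S, countable D & dense D.

Lemma prob_pairing_continuous (f : {f : S -> R^o | Cb S f}) :
  continuous (prob_pairing f : prob_weak S -> R^o).
Proof.
move=> mu A nA.
have /cvg_sup/(_ f) : nbhs (mu : prob_weak S) --> (mu : prob_weak S) by exact: cvg_id.
by apply; exact: initial_continuous nA.
Qed.

Lemma BL_Cb (f : S -> R) : BL f -> Cb S f.
Proof. by move=> [bf /lipschitz_continuous cf]; split. Qed.

Lemma pairing_weak_near (f : S -> R) (mu0 : prob_weak S) (e : R) :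
  BL f -> 0 < e ->
  \forall mu \near mu0, `|pairing (mu : prob S) f - pairing (mu0 : prob S) f| < e.
Proof.
move=> BLf e0; have := @prob_pairing_continuous (exist _ f (BL_Cb BLf)) mu0.
by move=> /cvgrPdist_lt/(_ e e0); apply: filterS => mu; rewrite distrC.
Qed.

(** Being close to [mu0] on a finite net of the unit ball and on [dist1 F] is a weak
    neighbourhood of [mu0]; every other element of the unit ball differs from the
    net by a multiple of [dist1 F], up to a small constant. *)
Lemma BL_dist_weak_near (mu0 : prob_weak S) (e : R) : 0 < e ->
  \forall mu \near mu0, BL_dist (mu : prob S) (mu0 : prob S) < e.
Proof.
move=> e0; pose c := e / 16; have c0 : 0 < c by rewrite divr_gt0.
have [F Fc] := dist1_pairing_small sepS (mu0 : prob S) c0.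
have [l [lB lnet]] := @finite_net R S F c [set f | BL f /\ BL_norm f <= 1]
  c0 (fun f x f1 => unit_ball_le1 f1 x).
have near_l : \forall mu \near mu0, forall h, h \in l ->
    `|pairing (mu : prob S) h - pairing (mu0 : prob S) h| < c.
  by apply: (@near_all_in_seq _ (nbhs mu0)) => h /lB[BLh _]; exact: pairing_weak_near.
have near_F := pairing_weak_near mu0 (dist1_BL F) c0.
apply: filterS2 near_l near_F => mu mul muF.
apply: le_lt_trans (_ : 9 * c < _); last by rewrite /c; lra.
rewrite BL_distE; apply: ge_sup.
  exact: (BL_dist_has_sup (mu : prob S) (mu0 : prob S)).1.
move=> _ [f [BLf f1] <-]; have [h hl fh] := lnet f (conj BLf f1).
have [BLh h1] := lB h hl.
have fhd x : `|f x - h x| <= c + 2 * dist1 F x.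
  apply: (le_dist1 (u := fun x => f x - h x)) => // [|y|y z]; first exact: ltW.
    have := unit_ball_le1 (conj BLf f1) y; have := unit_ball_le1 (conj BLh h1) y.
    by move=> h1' f1'; rewrite (le_trans (ler_normB _ _))//; lra.
  have -> : f y - h y - (f z - h z) = (f y - f z) - (h y - h z) by ring.
  have := BL_unit_ball_lip BLf f1 y z; have := BL_unit_ball_lip BLh h1 y z.
  by move=> h1' f1'; rewrite (le_trans (ler_normB _ _))//; lra.
have bd := BL_bounded_borel (dist1_BL F).
have bZ := bounded_borelZ 2 bd; have bC := @bounded_borel_cst R S c.
have mass1 (m : prob S) : mass m = 1.
  by rewrite /mass prob_mass.
have dm (m : prob S) : `|pairing m f - pairing m h| <= c + 2 * pairing m (dist1 F).
  have := le_dist_pairing m (BL_bounded_borel BLf) (BL_bounded_borel BLh)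
    (bounded_borelD bC bZ) fhd.
  by rewrite (pairingD _ bC bZ) (pairingZ _ _ bd) (pairing_cst _ c) mass1 mulr1.
have := dm mu; have := dm mu0; have := mul h hl; move: muF Fc.
rewrite !ltr_norml !ler_norml => /andP[_ ?] ? /andP[? ?] /andP[? ?] /andP[? ?].
by apply/andP; split; lra.
Qed.

End weak_topology.

(** * Dirac measures *)

Section dirac_measures.
Context {R : realType} {S : pmetricType R}.

Section dirac_at.
Variable x : S.

(** The library measure [\d_x] takes the value 1 on every set containing [x], Borel or
    not, whereas elements of [posmeas] vanish off the Borel sets. *)
Definition borel_dirac (A : set (borel S)) : \bar R :=
  if `[< measurable A >] then \d_(x : borel S) A else 0%E.

Let borel_diracE A : measurable A -> borel_dirac A = \d_(x : borel S) A.
Proof. by move=> mA; rewrite /borel_dirac asboolT. Qed.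

Let borel_dirac0 : borel_dirac set0 = 0%E.
Proof. by rewrite borel_diracE// measure0. Qed.

Let borel_dirac_ge0 A : (0 <= borel_dirac A)%E.
Proof. by rewrite /borel_dirac; case: ifP. Qed.

Let borel_dirac_sigma_additive : semi_sigma_additive borel_dirac.
Proof.
move=> F mF tF mUF; rewrite (borel_diracE mUF).
have -> : (fun n => \sum_(0 <= i < n) borel_dirac (F i))%E =
    (fun n => \sum_(0 <= i < n) \d_(x : borel S) (F i))%E.
  by apply/funext => n; apply: eq_bigr => i _; exact: borel_diracE.
exact: measure_semi_sigma_additive.
Qed.

HB.instance Definition _ := isMeasure.Build _ (borel S) R borel_dirac
  borel_dirac0 borel_dirac_ge0 borel_dirac_sigma_additive.

Let borel_dirac_fin : fin_num_fun borel_dirac.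
Proof. by move=> A mA; rewrite borel_diracE// fin_num_measure. Qed.

HB.instance Definition _ :=
  Measure_isFinite.Build _ (borel S) R borel_dirac borel_dirac_fin.

Fact borel_dirac_out A : ~ measurable A -> borel_dirac A = 0%E.
Proof. by move=> nA; rewrite /borel_dirac asboolF. Qed.

Definition posmeas_dirac : posmeas S := @PosMeas R S borel_dirac borel_dirac_out.

Fact posmeas_dirac_mass : posmeas_dirac setT = 1%E.
Proof. by rewrite /= borel_diracE// diracT. Qed.

Definition prob_dirac : prob S := Prob posmeas_dirac_mass.

Lemma pairing_dirac (f : S -> R) : bounded_borel f -> pairing posmeas_dirac f = f x.
Proof.
move=> [mf _]; rewrite /pairing /Rintegral.
rewrite (@eq_measure_integral _ _ _ _ (dirac (x : borel S))).
  by rewrite integral_dirac//; [rewrite diracT mul1e | exact/measurable_EFinP].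
by move=> A mA _; exact: borel_diracE.
Qed.

End dirac_at.

Lemma prob_dirac_continuous : continuous (prob_dirac : S -> prob_weak S).
Proof.
move=> x; apply/cvg_sup => f.
apply: (@continuous_comp_initial (prob S) S R^o (prob_pairing f)).
have -> : prob_pairing f \o prob_dirac = sval f.
  apply/funext => y; case: f => f [cf bf] /=.
  by apply: pairing_dirac; split => //; exact: continuous_borel.
by case: f => f [].
Qed.

End dirac_measures.

(** * Families of regular Markov operators *)

Section markov_operators.
Context {R : realType} {S : pmetricType R}.
Implicit Types (mu nu : posmeas S).

Lemma BM_bounded_borel (f : BM S) : bounded_borel f.
Proof. by case: f => f /= /set_mem. Qed.

Lemma dual_operatorE (P : markov_operator S) (U : {linear BM S -> BM S}) :
  dual_operator P U -> forall f x, U f x = pairing (P (posmeas_dirac x)) f.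
Proof. by move=> PU f x; rewrite PU pairing_dirac//; exact: BM_bounded_borel. Qed.

Lemma dual_operator_bound (P : markov_operator S) (U : {linear BM S -> BM S}) :
  dual_operator P U -> forall (f : BM S) (M : R), (forall x, `|f x| <= M) ->
  forall x, `|U f x| <= M.
Proof.
move=> PU f M fM x; rewrite (dual_operatorE PU).
have := @le_norm_pairing _ _ (P (posmeas_dirac x)) _ _ (BM_bounded_borel f)
  (bounded_borel_cst M) fM.
by rewrite pairing_cst /mass markov_mass posmeas_dirac_mass mulr1.
Qed.

Lemma mass_le_BL_dist mu nu :
  mass mu <= mass nu + 2 * BL_dist mu nu.
Proof.
have := @pairing_BL_dist _ _ 1 1 (cst 1) mu nu ltr01.
rewrite !pairing_cst !mul1r => h; rewrite -lerBlDl (le_trans (ler_norm _))//.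
apply: h => x; first by rewrite normr1.
by move=> y; rewrite subrr normr0 mul1r mdist_ge0.
Qed.

Section family.
Hypothesis sepS : exists2 D : set S, countable D & dense D.
Variables (Lambda : Type) (P : Lambda -> markov_operator S).
Variable U : Lambda -> {linear BM S -> BM S}.
Hypothesis PU : forall l, dual_operator (P l) (U l).

(** Each [f] is handled through its equicontinuous family [U l f]; the passage to the
    supremum over all [f] is the Schur property. *)
Lemma dual_equicontinuous_cvg (la : nat -> Lambda) (mu : nat -> posmeas S) mu0 :
  (forall f : BM S, BL f -> forall x,
    equicontinuous_at (fun l => U l f : S -> R^o) x) ->
  (forall n, BL_dist (mu n) mu0 < n.+1%:R^-1) ->
  BL_dist (P (la n) (mu n)) (P (la n) mu0) @[n --> \oo] --> (0 : R).
Proof.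
move=> ecU mu_mu0.
apply: (schur_property sepS (M := 2 * mass mu0 + 2)) => [n|f BLf].
  rewrite /mass !markov_mass -!/(mass _); have := mass_le_BL_dist (mu n) mu0.
  have : BL_dist (mu n) mu0 <= 1.
    by rewrite (le_trans (ltW (mu_mu0 n)))// invf_le1// ler1n.
  lra.
have [g gf] := BL_BM BLf; have BLg : BL g by rewrite gf.
have [M [k [_ gM _]]] := BL_elim BLg.
rewrite -gf; apply/cvgr0Pnorm_lt => e e0.
have [d d0 dP] := @equicontinuous_tests_uniform _ _ _ (fun l => U l g : S -> R^o) M
  (ecU g BLg) (fun l x => dual_operator_bound (PU l) gM x) mu0 e e0.
have := near_infty_natSinv_lt (PosNum d0); apply: filterS => n nd.
by rewrite !PU; apply: dP; exact: lt_trans (mu_mu0 n) nd.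
Qed.

(** Otherwise some [e] and, for each [n], some operator and some measure within
    [n.+1%:R^-1] of [mu0] would contradict the sequential version. *)
Lemma dual_equicontinuous_BL :
  (forall f : BM S, BL f -> forall x,
    equicontinuous_at (fun l => U l f : S -> R^o) x) ->
  forall mu0 : posmeas_BL S, equicontinuous_at (fun l => P l : posmeas_BL S -> posmeas_BL S) mu0.
Proof.
move=> ecU mu0 e e0; apply: contrapT => nec.
have bad n : exists p : Lambda * posmeas S,
    BL_dist p.2 mu0 < n.+1%:R^-1 /\ e <= BL_dist (P p.1 p.2) (P p.1 mu0).
  apply: contrapT => nobad; apply: nec.
  exists (ball (mu0 : posmeas_BL S) n.+1%:R^-1)^° => [|l mu].
    by split; [exact: open_interior | apply: nbhsx_ballx; rewrite invr_gt0].
  move=> /interior_subset; rewrite ballEmdist/= metric_sym => mu_mu0.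
  rewrite ltNge; apply/negP => emu; apply: nobad; exists (l, mu); split => //.
have [p pP] := choice bad.
have /cvgr0Pnorm_lt/(_ e e0)[n _ /(_ n (leqnn n))] :=
  @dual_equicontinuous_cvg (fun n => (p n).1) (fun n => (p n).2) mu0 ecU
    (fun n => (pP n).1).
by rewrite /= ltNge (le_trans (pP n).2)// ler_norm.
Qed.

Lemma BL_equicontinuous_weak :
  (forall mu0 : posmeas_BL S, equicontinuous_at (fun l => P l : posmeas_BL S -> posmeas_BL S) mu0) ->
  forall mu0 : prob_weak S,
    equicontinuous_at (fun l => markov_prob (P l) : prob_weak S -> prob_BL S) mu0.
Proof.
move=> ecP mu0 e e0; have [A oA AP] := ecP (mu0 : prob S) e e0.
have /nbhs_ballP[d /= d0 dA] := open_nbhs_nbhs oA.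
have near_mu0 := BL_dist_weak_near sepS mu0 d0.
exists (interior [set mu : prob_weak S | BL_dist (mu : prob S) (mu0 : prob S) < d]).
  by split; [exact: open_interior | exact: near_mu0].
move=> l mu /interior_subset /= mu_mu0; apply: AP; apply: dA.
by rewrite ballEmdist/= metric_sym.
Qed.

(** [U l f x] is the pairing of [f] with the image of the Dirac measure at [x], which
    depends weakly continuously on [x]. *)
Lemma weak_equicontinuous_dual :
  (forall mu0 : prob_weak S,
    equicontinuous_at (fun l => markov_prob (P l) : prob_weak S -> prob_BL S) mu0) ->
  forall f : BM S, BL f -> forall x,
    equicontinuous_at (fun l => U l f : S -> R^o) x.
Proof.
move=> ecP f /BL_elim[M [k [k0 fM fk]]] x e e0.
have Mk : 0 < M + k by rewrite ltr_wpDl// (le_trans _ (fM point)).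
have [A [oA Ax] AP] := ecP (prob_dirac x) (e / (M + k)) (divr_gt0 e0 Mk).
exists ((prob_dirac : S -> prob_weak S) @^-1` A).
  split=> //; move/continuousP: (@prob_dirac_continuous R S); exact.
move=> l y /(AP l) /= ly.
change (`|U l f x - U l f y| < e); rewrite distrC !(dual_operatorE (PU l)).
apply: le_lt_trans (pairing_BL_dist _ _ k0 fM fk) _.
by rewrite mulrC -ltr_pdivlMr.
Qed.

End family.

End markov_operators.

Theorem theorem3p3 (R : realType) (S : completeMetricType R)
    (sepS : exists2 D : set S, countable D & dense D)
    (Lambda : Type) (P : Lambda -> markov_operator S)
    (U : Lambda -> {linear BM S -> BM S})
    (PU : forall l, dual_operator (P l) (U l)) :
  [<->
    (forall f : BM S, BL f ->
       equicontinuous_in (Cb S) (fun l => U l f : S -> R^o)) ;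
    equicontinuous_in [set F | continuous F]
      (fun l => P l : posmeas_BL S -> posmeas_BL S) ;
    equicontinuous_in [set F | continuous F]
      (fun l => markov_prob (P l) : prob_weak S -> prob_BL S) ].
Proof.
tfae.
- move=> ecU.
  have ecP := dual_equicontinuous_BL sepS PU (fun f BLf => (ecU f BLf).2).
  by split; [exact: equicontinuous_continuous ecP | exact: ecP].
- move=> [_ ecP]; have ecW := BL_equicontinuous_weak sepS ecP.
  by split; [exact: equicontinuous_continuous ecW | exact: ecW].
- move=> [_ ecW] f BLf; have ecU := weak_equicontinuous_dual PU ecW BLf.
  split; last exact: ecU.
  move=> l; split; first exact: equicontinuous_continuous ecU l.
  exact: (BM_bounded_borel (U l f)).2.
Qed.
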